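(* Let $(A,\rho,[\cdot,\cdot])$ be a Lie algebroid on a smooth manifold $M$, $\Pi\in\Gamma(\wedge^2A)$, $\xi\in\Gamma(A)$ and $\lambda\in\Gamma(A^\star)$. For $\alpha,\beta,\gamma\in\Gamma(A^\star)$ let $$J^\lambda_{\Pi,\xi}(\alpha,\beta,\gamma)=\oint\left[[\alpha,\beta]^\lambda_{\Pi,\xi},\gamma\right]^\lambda_{\Pi,\xi}.$$ Then $$\begin{aligned}J^\lambda_{\Pi,\xi}(\alpha,\beta,\gamma)={}&\oint\mathcal{L}^\rho_{(\frac12[\Pi,\Pi]-\xi\wedge\Pi)(\alpha,\beta,\cdot)}\gamma+\Big[(2\xi\wedge\Pi-[\Pi,\Pi])(\alpha,\beta,\gamma)+\oint\gamma(\xi)\,\mathcal{L}^\rho_\xi\Pi(\alpha,\beta)\Big]\lambda\\&+d_\rho\big((2\xi\wedge\Pi-[\Pi,\Pi])(\alpha,\beta,\gamma)\big)-\oint\gamma(\xi)\,\mathcal{L}^\rho_\xi([\cdot,\cdot]_\Pi)(\alpha,\beta)\\&+\oint\mathcal{L}^\rho_\xi\Pi(\alpha,\beta)\,(\mathcal{L}^\rho_\xi\gamma-\gamma)+\oint\Pi(\alpha,\beta)\left(\mathcal{L}^\rho_\xi\gamma-[\lambda,\gamma]^\lambda_{\Pi,\xi}\right),\end{aligned}$$ where $\mathcal{L}^\rho_\xi([\cdot,\cdot]_\Pi)(\alpha,\beta)=\mathcal{L}^\rho_\xi([\alpha,\beta]_\Pi)-[\mathcal{L}^\rho_\xi\a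lpha,\beta]_\Pi-[\alpha,\mathcal{L}^\rho_\xi\beta]_\Pi$.
   Context: $\oint$ denotes the cyclic sum over $\alpha,\beta,\gamma$. A Lie algebroid on $M$ is a vector bundle $A\to M$ with a vector bundle morphism $\rho:A\to TM$ (the anchor) and a skew-symmetric $\mathbb{R}$-bilinear bracket on $\Gamma(A)$ satisfying $[a,\varphi b]=\varphi[a,b]+(\rho(a)\cdot\varphi)b$ and the Jacobi identity. Lie derivative: $\mathcal{L}^\rho_a\varphi=\rho(a)\cdot\varphi$, $(\mathcal{L}^\rho_a\eta)(a_1,\dots,a_k)=\rho(a)\cdot\eta(a_1,\dots,a_k)-\sum_i\eta(a_1,\dots,[a,a_i],\dots,a_k)$ for $\eta\in\Gamma(\wedge^kA^\star)$, and $\langle\mathcal{L}^\rho_aP,\eta\rangle=\rho(a)\cdot\langle P,\eta\rangle-\langle P,\mathcal{L}^\rho_a\eta\rangle$ for multivector fields $P\in\Gamma(\wedge^\bullet A)$. For a function $\varphi$, $d_\rho\varphi(a)=\rho(a)\cdot\varphi$. The Schouten–Nijenhuis bracket on $\Gamma(\wedge^\bullet A)$ is the unique $\mathbb{R}$-bilinear bracket with $[\varphi,\psi]=0$ for functions, $[a,P]=\mathcal{L}^\rho_aP$ for $a\in\Gamma(A)$, $[P,Q]=(-1)^{kl}[Q,P]$ and $[P,Q\wedge R]=[P,Q]\wedge R+(-1)^{(k+1)l}Q\wedge[P,R]$ for $P\in\Gamma(\wedge^kA)$, $Q\in\Gamma(\wedge^lA)$. Exterior products are normalised so that $(\xi\wedge\Pi)(\alpha,\beta,\gamma)=\oint\alpha(\xi)\Pi(\beta,\gamma)$.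 For a section $T$ of $\wedge^3A$, $T(\alpha,\beta,\cdot)$ denotes the section of $A$ characterised by $\gamma(T(\alpha,\beta,\cdot))=T(\alpha,\beta,\gamma)$. $\sharp_\Pi:A^\star\to A$ is defined by $\beta(\sharp_\Pi(\alpha))=\Pi(\alpha,\beta)$; the Koszul bracket is $[\alpha,\beta]_\Pi=\mathcal{L}^\rho_{\sharp_\Pi(\alpha)}\beta-\mathcal{L}^\rho_{\sharp_\Pi(\beta)}\alpha-d_\rho(\Pi(\alpha,\beta))$; and $$[\alpha,\beta]^\lambda_{\Pi,\xi}=[\alpha,\beta]_\Pi+\alpha(\xi)(\mathcal{L}^\rho_\xi\beta-\beta)-\beta(\xi)(\mathcal{L}^\rho_\xi\alpha-\alpha)-\Pi(\alpha,\beta)\lambda.$$ *)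

(* Defs.v *)
From HB Require Import structures.
From mathcomp Require Import all_boot all_order all_algebra.
From mathcomp Require Import all_classical all_reals all_analysis.
From mathcomp Require Import ring.
Import Order.TTheory GRing.Theory Num.Theory.
Import numFieldNormedType.Exports.

Set Implicit Arguments.
Unset Strict Implicit.
Unset Printing Implicit Defensive.

Local Open Scope classical_set_scope.
Local Open Scope ring_scope.

Section SmoothEuclidean.
Context {R : realType} {n : nat}.
Implicit Types (U : set 'rV[R]_n) (f g : 'rV[R]_n -> R).

(* For U open, f is of class C^(k+1) on U iff it is (Frechet) differentiable
   on U and all its directional derivatives are of class C^k on U. *)
Fixpoint Ck (k : nat) U f : Prop :=
  match k with
  | 0%N => forall x, U x -> {for x, continuous f}
  | k'.+1 => (forall x, U x -> differentiable f x) /\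
             forall v : 'rV[R]_n, Ck k' U ('D_v f)
  end.

Definition smooth_on U f := forall k, Ck k U f.

Lemma Ck_sub k U U' f : U' `<=` U -> Ck k U f -> Ck k U' f.
Proof.
move=> sub; elim: k f => [|k IH] f /=; first by move=> h x /sub; exact: h.
by move=> [h1 h2]; split=> [x /sub|v]; [exact: h1 | exact/IH/h2].
Qed.

Lemma near_eq_differentiable f g x :
  (\near x, f x = g x) -> differentiable f x -> differentiable g x.
Proof.
move=> fg df; have [dfc /eqaddoP fE] := (diff_locallyP x f).1 df.
have fgx : f x = g x by exact: nbhs_singleton fg.
have gE : g \o shift x = cst (g x) + 'd f x +o_ 0 id.
  apply/eqaddoP => e e0; near=> h.
  have gf : g (h + x) = f (h + x).
    by apply/esym; near: h; move: fg; rewrite (near_shift 0) subr0.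
  rewrite !fctE /= gf -fgx; near: h; exact: fE.
apply/diff_locallyP; rewrite (diff_unique dfc gE); split => //.
Unshelve. all: by end_near. Qed.

Lemma Ck_ext k U f g : open U -> (forall x, U x -> f x = g x) ->
  Ck k U f -> Ck k U g.
Proof.
move=> oU; elim: k f g => [|k IH] f g fg.
  move=> fc x Ux; have fgx : \near x, f x = g x.
    by apply: filterS (open_nbhs_nbhs (conj oU Ux)) => y; exact: fg.
  suff : g @ x --> g x by [].
  rewrite -(fg x Ux); apply: cvg_trans (fc x Ux).
  exact: (near_eq_cvg fgx).
have fgx x : U x -> \near x, f x = g x.
  by move=> Ux; apply: filterS (open_nbhs_nbhs (conj oU Ux)) => y; exact: fg.
move=> [h1 h2]; split=> [x Ux|v]; first exact: near_eq_differentiable (fgx x Ux) (h1 x Ux).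
apply: IH (h2 v) => x Ux; exact/near_eq_derive/fgx.
Qed.

Lemma Ck_le k U f : Ck k.+1 U f -> Ck k U f.
Proof.
elim: k f => [|k IH] f; first by case=> h _ x Ux; exact/differentiable_continuous/h.
by case=> h1 h2; split=> // v; exact/IH/h2.
Qed.

Lemma Ck_cst k U (c : R) : Ck k U (cst c).
Proof.
elim: k c => [|k IH] c; first by move=> x _; exact: cst_continuous.
split=> [x _|v]; first exact: differentiable_cst.
by rewrite (_ : 'D_v (cst c) = cst 0); [exact: IH | apply/funext => x; exact: derive_cst].
Qed.

Lemma CkB k U f g : open U -> Ck k U f -> Ck k U g -> Ck k U (f - g).
Proof.
move=> oU; elim: k f g => [|k IH] f g.
  by move=> hf hg x Ux; apply: continuousB; [exact: hf | exact: hg].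
move=> [f1 f2] [g1 g2]; split=> [x Ux|v].
  by apply: differentiableB; [exact: f1 | exact: g1].
apply: (Ck_ext oU _ (IH _ _ (f2 v) (g2 v))) => x Ux.
by rewrite deriveB //; apply: diff_derivable; [exact: f1 | exact: g1].
Qed.

Lemma CkD k U f g : open U -> Ck k U f -> Ck k U g -> Ck k U (f + g).
Proof.
move=> oU hf hg; rewrite (_ : f + g = f - (cst 0 - g)).
  by apply: CkB => //; apply: CkB => //; exact: Ck_cst.
by apply/funext => x; rewrite !fctE /= sub0r opprK.
Qed.

Lemma CkM k U f g : open U -> Ck k U f -> Ck k U g -> Ck k U (f * g).
Proof.
move=> oU; elim: k f g => [|k IH] f g.
  by move=> hf hg x Ux; apply: continuousM; [exact: hf | exact: hg].
move=> hf hg; have [f1 f2] := hf; have [g1 g2] := hg; split=> [x Ux|v].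
  by apply: differentiableM; [exact: f1 | exact: g1].
have := CkD oU (IH _ _ (Ck_le hf) (g2 v)) (IH _ _ (Ck_le hg) (f2 v)).
apply: Ck_ext => // x Ux.
by rewrite deriveM //; apply: diff_derivable; [exact: f1 | exact: g1].
Qed.

End SmoothEuclidean.

Record smooth_manifold (R : realType) (n : nat) := SmoothManifold {
  mspace :> topologicalType;
  mspace_hausdorff : hausdorff_space mspace;
  mspace_second_countable : @second_countable mspace;
  chart_idx : Type;
  chart_dom : chart_idx -> set mspace;
  chart_cod : chart_idx -> set 'rV[R]_n;
  chart : chart_idx -> mspace -> 'rV[R]_n;
  (* the inverse of the chart, relevant on [chart_cod i] only *)
  param : chart_idx -> 'rV[R]_n -> mspace;
  open_chart_dom : forall i, open (chart_dom i);
  open_chart_cod : forall i, open (chart_cod i);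
  chart_domE : forall i x, chart_dom i x -> chart_cod i (chart i x);
  param_codE : forall i y, chart_cod i y -> chart_dom i (param i y);
  chartK : forall i x, chart_dom i x -> param i (chart i x) = x;
  paramK : forall i y, chart_cod i y -> chart i (param i y) = y;
  chart_continuous :
    forall i x, chart_dom i x -> {for x, continuous (chart i)};
  param_continuous :
    forall i y, chart_cod i y -> {for y, continuous (param i)};
  chart_cover : forall x, exists i, chart_dom i x;
  chart_compat : forall i j (k : 'I_n),
    smooth_on (chart_cod i `&` param i @^-1` chart_dom j)
              (fun y => chart j (param i y) 0 k)
}.

Section SmoothFunctions.
Context {R : realType} {n : nat} (M : smooth_manifold R n).
Implicit Types (W : set M) (f g : M -> R) (x : M).

Definition smooth_in W f := forall i : chart_idx M,
  smooth_on (chart_cod i `&` param i @^-1` W) (f \o param i).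

Lemma open_param_preimage i W :
  open W -> open (chart_cod i `&` @param _ _ M i @^-1` W).
Proof.
move=> oW; rewrite openE => y [cy Wy]; rewrite /interior; apply: filterI.
  by apply: open_nbhs_nbhs; split=> //; exact: open_chart_cod.
by apply: (param_continuous cy); apply: open_nbhs_nbhs.
Qed.

Lemma smooth_in_sub W W' f : W' `<=` W -> smooth_in W f -> smooth_in W' f.
Proof.
by move=> sub h i k; apply: Ck_sub (h i k) => y [cy Wy]; split=> //; exact: sub.
Qed.

Lemma smooth_in_cst W (c : R) : smooth_in W (cst c).
Proof. by move=> i k; exact: Ck_cst. Qed.

Lemma smooth_inB W f g :
  open W -> smooth_in W f -> smooth_in W g -> smooth_in W (f - g).
Proof.
move=> oW hf hg i k; have oU := open_param_preimage (i := i) oW.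
exact: CkB oU (hf i k) (hg i k).
Qed.

Lemma smooth_inD W f g :
  open W -> smooth_in W f -> smooth_in W g -> smooth_in W (f + g).
Proof.
move=> oW hf hg i k; have oU := open_param_preimage (i := i) oW.
exact: CkD oU (hf i k) (hg i k).
Qed.

Lemma smooth_inM W f g :
  open W -> smooth_in W f -> smooth_in W g -> smooth_in W (f * g).
Proof.
move=> oW hf hg i k; have oU := open_param_preimage (i := i) oW.
exact: CkM oU (hf i k) (hg i k).
Qed.

Definition smooth_pred : {pred (M -> R)} := fun f => `[< smooth_in setT f >].

Lemma smooth_subring : subring_closed smooth_pred.
Proof.
split=> [|f g /asboolP hf /asboolP hg|f g /asboolP hf /asboolP hg]; apply/asboolP.
- exact: smooth_in_cst.
- exact: smooth_inB openT hf hg.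
- exact: smooth_inM openT hf hg.
Qed.

(* The ring C^oo(M). *)
Record smooth_fun := SmoothFun {
  smooth_val :> M -> R;
  _ : smooth_val \in smooth_pred
}.

HB.instance Definition _ := [isSub for smooth_val].
HB.instance Definition _ := [Choice of smooth_fun by <:].
HB.instance Definition _ := GRing.SubChoice_isSubComPzRing.Build
  (M -> R) smooth_pred smooth_fun smooth_subring.

Lemma smooth_funP (f : smooth_fun) : smooth_in setT f.
Proof. by case: f => f /= /asboolP. Qed.

Definition mk_smooth f (hf : smooth_in setT f) : smooth_fun :=
  SmoothFun (asboolT hf).

Definition smooth_cst (c : R) : smooth_fun := mk_smooth (smooth_in_cst setT c).

(* A tangent vector at x is a derivation at x of C^oo(M). *)
Record tangent x := Tangent {
  tangent_val :> smooth_fun -> R;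
  tangent_linear : forall (c : R) (f g : smooth_fun),
    tangent_val (smooth_cst c * f + g) = c * tangent_val f + tangent_val g;
  tangent_leibniz : forall f g : smooth_fun,
    tangent_val (f * g) = f x * tangent_val g + g x * tangent_val f
}.

End SmoothFunctions.

(* A smooth vector bundle of rank r, given by its fibers and a bundle atlas:
   [triv i x] is the restriction to the fiber at x of the i-th local
   trivialisation, relevant for x in [triv_dom i] only. *)
Record vector_bundle (R : realType) (n : nat) (M : smooth_manifold R n)
    (r : nat) := VectorBundle {
  fiber :> M -> lmodType R;
  triv_idx : Type;
  triv_dom : triv_idx -> set M;
  triv : triv_idx -> forall x, {linear fiber x -> 'rV[R]_r};
  transition : triv_idx -> triv_idx -> M -> 'M[R]_r;
  open_triv_dom : forall i, open (triv_dom i);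
  triv_cover : forall x, exists i, triv_dom i x;
  triv_bij : forall i x, triv_dom i x -> bijective (triv i x);
  transitionE : forall i j x (v : fiber x), triv_dom i x -> triv_dom j x ->
    triv j x v = triv i x v *m transition i j x;
  transition_smooth : forall i j (k l : 'I_r),
    smooth_in (triv_dom i `&` triv_dom j) (fun x => transition i j x k l)
}.

Section Sections.
Context {R : realType} {n r : nat} {M : smooth_manifold R n}.
Variable A : vector_bundle M r.

Definition smooth_section (s : forall x, A x) :=
  forall (i : triv_idx A) (k : 'I_r),
    smooth_in (triv_dom i) (fun x => triv i x (s x) 0 k).

(* The C^oo(M)-module Gamma(A). *)
Record section := Section_ {
  section_val :> forall x, A x;
  section_smooth : smooth_section section_val
}.

Lemma section_eq (a b : section) : (forall x, a x = b x) -> a = b.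
Proof.
case: a b => [a ha] [b hb] /= ab.
have e : a = b by apply: functional_extensionality_dep.
by case: _ / e hb => hb; congr Section_; exact: Prop_irrelevance.
Qed.

HB.instance Definition _ := gen_eqMixin section.
HB.instance Definition _ := gen_choiceMixin section.

Lemma smooth_section0 : smooth_section (fun=> 0).
Proof.
move=> i k; rewrite (_ : (fun _ => _) = cst 0); first exact: smooth_in_cst.
by apply/funext => x; rewrite linear0 mxE.
Qed.

Lemma smooth_sectionN (a : section) : smooth_section (fun x => - a x).
Proof.
move=> i k.
rewrite (_ : (fun _ => _) = cst 0 - (fun x => triv i x (a x) 0 k)).
  by apply: smooth_inB; [exact: open_triv_dom|exact: smooth_in_cst|exact: section_smooth].
by apply/funext => x; rewrite linearN mxE !fctE sub0r.
Qed.

Lemma smooth_sectionD (a b : section) : smooth_section (fun x => a x + b x).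
Proof.
move=> i k.
rewrite (_ : (fun _ => _) = (fun x => triv i x (a x) 0 k)
                            + (fun x => triv i x (b x) 0 k)).
  by apply: smooth_inD; [exact: open_triv_dom|exact: section_smooth..].
by apply/funext => x; rewrite linearD mxE.
Qed.

Lemma smooth_sectionZ (f : smooth_fun M) (a : section) :
  smooth_section (fun x => f x *: a x).
Proof.
move=> i k.
rewrite (_ : (fun _ => _) = (f : M -> R) * (fun x => triv i x (a x) 0 k)).
  apply: smooth_inM; [exact: open_triv_dom| |exact: section_smooth].
  by apply: smooth_in_sub (smooth_funP f).
by apply/funext => x; rewrite linearZ mxE.
Qed.

Definition section0 := Section_ smooth_section0.
Definition sectionN a := Section_ (smooth_sectionN a).
Definition sectionD a b := Section_ (smooth_sectionD a b).
Definition sectionZ f a := Section_ (smooth_sectionZ f a).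

Lemma sectionDA : associative sectionD.
Proof. by move=> a b c; apply: section_eq => x /=; rewrite addrA. Qed.
Lemma sectionDC : commutative sectionD.
Proof. by move=> a b; apply: section_eq => x /=; rewrite addrC. Qed.
Lemma section0D : left_id section0 sectionD.
Proof. by move=> a; apply: section_eq => x /=; rewrite add0r. Qed.
Lemma sectionND : left_inverse section0 sectionN sectionD.
Proof. by move=> a; apply: section_eq => x /=; rewrite addNr. Qed.

HB.instance Definition _ := GRing.isZmodule.Build section
  sectionDA sectionDC section0D sectionND.

Lemma sectionZA f g a : sectionZ f (sectionZ g a) = sectionZ (f * g) a.
Proof. by apply: section_eq => x /=; rewrite scalerA. Qed.
Lemma section1Z : left_id 1 sectionZ.
Proof. by move=> a; apply: section_eq => x /=; rewrite scale1r. Qed.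
Lemma sectionZDr : right_distributive sectionZ +%R.
Proof. by move=> f a b; apply: section_eq => x /=; rewrite scalerDr. Qed.
Lemma sectionZDl a : {morph sectionZ^~ a : f g / f + g}.
Proof. by move=> f g; apply: section_eq => x /=; rewrite scalerDl. Qed.

HB.instance Definition _ := GRing.Zmodule_isLmodule.Build (smooth_fun M) section
  sectionZA section1Z sectionZDr sectionZDl.

(* The C^oo(M)-module Gamma(A^* ), identified as usual with the module of
   C^oo(M)-linear maps Gamma(A) -> C^oo(M). *)
Record covector := Covector {
  covector_val :> section -> smooth_fun M;
  covectorP : forall (f : smooth_fun M) (a b : section),
    covector_val (f *: a + b) = f * covector_val a + covector_val b
}.

Lemma covector_eq (al be : covector) : (forall a, al a = be a) -> al = be.
Proof.
case: al be => [al h1] [be h2] /= ab; have e : al = be by apply/funext.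
by case: _ / e h2 => h2; congr Covector; exact: Prop_irrelevance.
Qed.

HB.instance Definition _ := gen_eqMixin covector.
HB.instance Definition _ := gen_choiceMixin covector.

Program Definition covector0 := @Covector (fun=> 0) _.
Next Obligation. by move=> * /=; rewrite mulr0 addr0. Qed.
Program Definition covectorN (al : covector) := @Covector (fun a => - al a) _.
Next Obligation. by move=> * /=; rewrite covectorP opprD mulrN. Qed.
Program Definition covectorD (al be : covector) :=
  @Covector (fun a => al a + be a) _.
Next Obligation. by move=> * /=; rewrite !covectorP mulrDr addrACA. Qed.
Program Definition covectorZ (f : smooth_fun M) (al : covector) :=
  @Covector (fun a => f * al a) _.
Next Obligation. by move=> * /=; rewrite covectorP mulrDr mulrCA. Qed.

Lemma covectorDA : associative covectorD.
Proof. by move=> a b c; apply: covector_eq => x /=; rewrite addrA. Qed.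
Lemma covectorDC : commutative covectorD.
Proof. by move=> a b; apply: covector_eq => x /=; rewrite addrC. Qed.
Lemma covector0D : left_id covector0 covectorD.
Proof. by move=> a; apply: covector_eq => x /=; rewrite add0r. Qed.
Lemma covectorND : left_inverse covector0 covectorN covectorD.
Proof. by move=> a; apply: covector_eq => x /=; rewrite addNr. Qed.

HB.instance Definition _ := GRing.isZmodule.Build covector
  covectorDA covectorDC covector0D covectorND.

Lemma covectorZA f g a : covectorZ f (covectorZ g a) = covectorZ (f * g) a.
Proof. by apply: covector_eq => x /=; rewrite mulrA. Qed.
Lemma covector1Z : left_id 1 covectorZ.
Proof. by move=> a; apply: covector_eq => x /=; rewrite mul1r. Qed.
Lemma covectorZDr : right_distributive covectorZ +%R.
Proof. by move=> f a b; apply: covector_eq => x /=; rewrite mulrDr. Qed.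
Lemma covectorZDl a : {morph covectorZ^~ a : f g / f + g}.
Proof. by move=> f g; apply: covector_eq => x /=; rewrite mulrDl. Qed.

HB.instance Definition _ := GRing.Zmodule_isLmodule.Build (smooth_fun M) covector
  covectorZA covector1Z covectorZDr covectorZDl.

(* The section of A whose value on every al in Gamma(A^* ) is [t al]; it is
   unique when it exists, and the default value is 0. *)
Definition section_of (t : covector -> smooth_fun M) : section :=
  xget 0 [set a : section | forall al : covector, al a = t al].

(* A k-vector field P is encoded by its values P(al_1, ..., al_k) on lists of
   elements of Gamma(A^* ), extended by 0 to the lists of other lengths. *)
Definition multivec := seq covector -> smooth_fun M.

Definition is_multivec (k : nat) (P : multivec) : Prop :=
  [/\ forall s, size s != k -> P s = 0,
      forall s1 s2 (f : smooth_fun M) (al be : covector),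
        P (s1 ++ (f *: al + be) :: s2)
        = f * P (s1 ++ al :: s2) + P (s1 ++ be :: s2)
    & forall s1 s2 s3 (al : covector),
        P (s1 ++ al :: s2 ++ al :: s3) = 0].

Definition mv_fun (f : smooth_fun M) : multivec :=
  fun s => if s is [::] then f else 0.

Definition mv_section (a : section) : multivec :=
  fun s => if s is [:: al] then al a else 0.

(* (P /\ Q)(al_1, ..., al_N) is the signed sum over the shuffles: the mask m
   selects the arguments passed to P, and [shuffle_inv m] is the number of
   inversions of the permutation putting these in front. *)
Definition shuffle_inv N (m : N.-tuple bool) : nat :=
  \sum_(i < N) \sum_(j < N | (i < j)%N) (~~ tnth m i && tnth m j).

Definition mv_wedge (P Q : multivec) : multivec := fun s =>
  \sum_(m : (size s).-tuple bool)
    (-1) ^+ shuffle_inv m * P (mask m s) * Q (mask (map negb m) s).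

(* A morphism of vector bundles A -> TM over the identity of M; it is smooth
   iff it maps smooth sections to smooth vector fields, and a vector field X
   is smooth iff X . f is smooth for every smooth function f. *)
Record anchor_map := AnchorMap {
  anchor_val : forall x, A x -> tangent x;
  anchor_linear : forall x (c : R) (u v : A x) (f : smooth_fun M),
    anchor_val (c *: u + v) f = c * anchor_val u f + anchor_val v f;
  anchor_smooth : forall (a : section) (f : smooth_fun M),
    smooth_in setT (fun x => anchor_val (a x) f)
}.

(* rho(a) . f *)
Definition anchor_act (rho : anchor_map) (a : section) (f : smooth_fun M) :
  smooth_fun M := mk_smooth (anchor_smooth rho a f).

Record lie_algebroid := LieAlgebroid {
  anchor :> anchor_map;
  bracket : section -> section -> section;
  bracket_linearl : forall (c : R) (a a' b : section),
    bracket (smooth_cst M c *: a + a') b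
    = smooth_cst M c *: bracket a b + bracket a' b;
  bracket_linearr : forall (c : R) (a b b' : section),
    bracket a (smooth_cst M c *: b + b')
    = smooth_cst M c *: bracket a b + bracket a b';
  bracket_skew : forall a b : section, bracket a b = - bracket b a;
  bracket_leibniz : forall (a b : section) (f : smooth_fun M),
    bracket a (f *: b) = f *: bracket a b + anchor_act anchor a f *: b;
  bracket_jacobi : forall a b c : section,
    bracket a (bracket b c) + bracket b (bracket c a)
    + bracket c (bracket a b) = 0
}.

End Sections.

Section LieAlgebroidCalculus.
Context {R : realType} {n r : nat} {M : smooth_manifold R n}.
Context {A : vector_bundle M r}.
Variable L : lie_algebroid A.
Local Notation F := (smooth_fun M).
Local Notation Gamma := (section A).
Local Notation Gamma' := (covector A).
Implicit Types (a b : Gamma) (f g : F) (al be : Gamma') (P Q T : multivec A).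

Lemma anchor_act_linear f a b g :
  anchor_act L (f *: a + b) g = f * anchor_act L a g + anchor_act L b g.
Proof. by apply/val_inj/funext => x; exact: anchor_linear. Qed.

Lemma anchor_actD a f g :
  anchor_act L a (f + g) = anchor_act L a f + anchor_act L a g.
Proof.
apply/val_inj/funext => x.
have := tangent_linear (anchor_val L (a x)) 1 f g.
have -> : smooth_cst M 1 = 1 by exact/val_inj.
by rewrite !mul1r.
Qed.

Lemma anchor_actM a f g :
  anchor_act L a (f * g) = f * anchor_act L a g + g * anchor_act L a f.
Proof. by apply/val_inj/funext => x; exact: tangent_leibniz. Qed.

Definition d_fun f : Gamma' :=
  Covector (fun g a b => anchor_act_linear g a b f).

Lemma lie_covector_subproof a al (f : F) (b c : Gamma) :
  anchor_act L a (al (f *: b + c)) - al (bracket L a (f *: b + c))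
  = f * (anchor_act L a (al b) - al (bracket L a b))
    + (anchor_act L a (al c) - al (bracket L a c)).
Proof.
have brD (x y z : Gamma) :
    bracket L x (y + z) = bracket L x y + bracket L x z.
  have one : smooth_cst M 1 = 1 by exact/val_inj.
  by have := bracket_linearr L 1 x y z; rewrite one !scale1r.
rewrite brD bracket_leibniz -addrA !covectorP anchor_actD anchor_actM; ring.
Qed.

(* The Lie derivative of a section of A^* *)
Definition lie_covector a al : Gamma' :=
  Covector (lie_covector_subproof a al).

(* The Lie derivative of a multivector field: the defining relation
   <L_a P, eta> = rho(a) . <P, eta> - <P, L_a eta>
   at eta = al_1 /\ ... /\ al_k, where <P, eta> = P(al_1, ..., al_k) and
   L_a eta = sum_i al_1 /\ ... /\ L_a al_i /\ ... /\ al_k. *)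
Definition lie_multivec a P : multivec A := fun s =>
  anchor_act L a (P s)
  - \sum_(i < size s) P (set_nth 0 s i (lie_covector a s`_i)).

(* Below, the degree of [P, Q] is k + l - 1; for k = l = 0 the truncated value
   0 is harmless since the bracket of two functions vanishes. *)
Record schouten_bracket := SchoutenBracket {
  schouten :> multivec A -> multivec A -> multivec A;
  schouten_multivec : forall k l P Q, is_multivec k P -> is_multivec l Q ->
    is_multivec (k + l).-1 (schouten P Q);
  schouten_linearl : forall k l (c : R) P P' Q,
    is_multivec k P -> is_multivec k P' -> is_multivec l Q ->
    forall s, schouten (fun t => smooth_cst M c * P t + P' t) Q s
              = smooth_cst M c * schouten P Q s + schouten P' Q s;
  schouten_linearr : forall k l (c : R) P Q Q',
    is_multivec k P -> is_multivec l Q -> is_multivec l Q' ->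
    forall s, schouten P (fun t => smooth_cst M c * Q t + Q' t) s
              = smooth_cst M c * schouten P Q s + schouten P Q' s;
  schouten_fun : forall f g s, schouten (mv_fun f) (mv_fun g) s = 0;
  schouten_section : forall k a P, is_multivec k P ->
    forall s, schouten (mv_section a) P s = lie_multivec a P s;
  schouten_sym : forall k l P Q, is_multivec k P -> is_multivec l Q ->
    forall s, schouten P Q s = (-1) ^+ (k * l) * schouten Q P s;
  schouten_wedge : forall k l m P Q T,
    is_multivec k P -> is_multivec l Q -> is_multivec m T ->
    forall s, schouten P (mv_wedge Q T) s
              = mv_wedge (schouten P Q) T s
                + (-1) ^+ (k.+1 * l) * mv_wedge Q (schouten P T) s
}.

(* T(al, be, .) *)
Definition mv_contract T al be : Gamma :=
  section_of (fun ga : Gamma' => T [:: al; be; ga]).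

Definition sharp (Pi : multivec A) al : Gamma :=
  section_of (fun be : Gamma' => Pi [:: al; be]).

Definition koszul (Pi : multivec A) al be : Gamma' :=
  lie_covector (sharp Pi al) be - lie_covector (sharp Pi be) al
  - d_fun (Pi [:: al; be]).

(* L_a([., .]_Pi)(al, be) *)
Definition lie_koszul a (Pi : multivec A) al be : Gamma' :=
  lie_covector a (koszul Pi al be) - koszul Pi (lie_covector a al) be
  - koszul Pi al (lie_covector a be).

(* [al, be]^lam_(Pi, xi) *)
Definition twisted_bracket (Pi : multivec A) (xi : Gamma) (lam : Gamma')
    al be : Gamma' :=
  koszul Pi al be
  + al xi *: (lie_covector xi be - be) - be xi *: (lie_covector xi al - al)
  - Pi [:: al; be] *: lam.

End LieAlgebroidCalculus.

Definition cyclic_sum {T : Type} {V : zmodType} (u : T -> T -> T -> V)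
  (al be ga : T) : V := u al be ga + u be ga al + u ga al be.

(* J^lam_(Pi, xi) *)
Definition jacobiator {R : realType} {n r : nat} {M : smooth_manifold R n}
    {A : vector_bundle M r} (L : lie_algebroid A) (Pi : multivec A)
    (xi : section A) (lam : covector A) :
    covector A -> covector A -> covector A -> covector A :=
  let br := twisted_bracket L Pi xi lam in
  cyclic_sum (fun al be ga => br (br al be) ga).

(* Main.v *)
Require Import Defs.
From mathcomp Require Import all_boot all_order all_algebra.
From mathcomp Require Import all_classical all_reals all_analysis.
From mathcomp Require Import ring lra.
Import Order.TTheory GRing.Theory Num.Theory.
Import numFieldNormedType.Exports.

Set Implicit Arguments.
Unset Strict Implicit.
Unset Printing Implicit Defensive.

Local Open Scope ring_scope.

(** The identity is a computation in the module of covectors, once two facts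
about sections and about the Schouten bracket are available.

Near every point there are a smooth function phi equal to 1, finitely many
global sections e_k and covectors ep_k with phi a = sum_k ep_k(a) e_k for every
section a ([local_frame], built from bump functions).  It follows that covectors
separate sections ([section_separated]) and that every C^oo(M)-linear map from
covectors to functions is the evaluation at a section ([section_ofP]); hence
#al and T(al, be, .) do have the values that define them.

The half square of the Schouten bracket is
  1/2 [Pi, Pi](al, be, ga) = cyc (#ga . Pi(al, be) - al([#be, #ga])),
a formula called [poisson_defect] below.  The rules of the bracket compute
[Pi, Q] when Q is a finite sum of products a /\ b.  The frame writes phi Pi as
such a sum, and multiplying by phi does not change [Pi, Pi] at the point
considered, because the derivation f |-> [Pi, f] kills, at that point, a
function that is constant nearby ([schouten_squareE]).

The defect also measures the failure of # to be a morphism: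
  #[al, be]_Pi = [#al, #be] + 1/2 [Pi, Pi](al, be, .)   ([sharp_koszul]).
With [L_a, L_b] = L_[a, b] this gives the Jacobiator of the Koszul bracket
([koszul_jacobi]).  The twisted bracket satisfies
  [f al, ga] = f [al, ga] - (#ga . f + ga(xi) xi . f) al,
so that the double bracket [[al, be], ga] can be expanded along the summands
of the inner bracket ([twisted_bracket_twice]).  In the cyclic sum, the
terms ga(xi) [al, be]_Pi, where the Koszul bracket is not differentiated, match
the Lie derivatives along (xi /\ Pi)(al, be, .), the differential of
(xi /\ Pi)(al, be, ga) and the terms Pi(al, be) L_xi ga
([twisted_jacobiator]). *)

(** * Smooth functions on open sets of R^n *)

Local Open Scope classical_set_scope.

Section Calculus.
Context {R : realType} {n : nat}.
Implicit Types (U : set 'rV[R]_n) (f g : 'rV[R]_n -> R).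

(** At each point of U, the condition of class C^k only involves the function,
which is defined on the whole space; so V may be any set containing x. *)
Lemma Ck_local k U f :
  (forall x, U x -> exists2 V, V x & Ck k (V `&` U) f) -> Ck k U f.
Proof.
elim: k f => [|k IH] f loc.
  by move=> x Ux; have [V Vx h] := loc x Ux; exact: (h x (conj Vx Ux)).
split=> [x Ux|v].
  by have [V Vx [h _]] := loc x Ux; exact: (h x (conj Vx Ux)).
by apply: IH => x Ux; have [V Vx [_ h]] := loc x Ux; exists V => //; exact: h.
Qed.

Lemma CkV k U f : open U -> (forall x, U x -> f x != 0) ->
  Ck k U f -> Ck k U (fun x => (f x)^-1).
Proof.
move=> oU f0; elim: k => [|k IH].
  move=> fc x Ux; apply: (@cvgV _ _ _ (nbhs_filter x) f _ (f0 x Ux)).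
  exact: (fc x Ux).
move=> hf; have [f1 f2] := hf; split=> [x Ux|v].
  by apply: differentiableV; [exact: f1 | exact: f0].
have i := IH (Ck_le hf).
have := CkM oU (CkM oU (CkM oU (Ck_cst k U (-1)) i) i) (f2 v).
apply: Ck_ext => // x Ux.
rewrite deriveV; [|exact: f0|by apply: diff_derivable; exact: f1].
change (-1 * (f x)^-1 * (f x)^-1 * 'D_v f x = - f x ^- 2 * 'D_v f x).
by rewrite expr2 invfM; ring.
Qed.

Lemma Ck_coord k U i : Ck k U (fun y : 'rV[R]_n => y 0 i).
Proof.
case: k => [x _|k]; first exact: coord_continuous.
split=> [x _|v]; first exact: differentiable_coord.
suff -> : 'D_v (fun y : 'rV[R]_n => y 0 i) = cst (v 0 i) by exact: Ck_cst.
apply/funext => x; rewrite deriveE; last exact: differentiable_coord.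
have @f : {linear 'rV[R]_n -> R}.
  by exists (fun N : 'rV[R]_n => N 0 i); do 2![eexists]; do ?[constructor];
     rewrite ?mxE// => ? *; rewrite ?mxE//; move=> ?; rewrite !mxE.
rewrite (_ : (fun y : 'rV[R]_n => y 0 i) = f) // diff_lin //.
exact: coord_continuous.
Qed.

Lemma derive_comp1 (h : R -> R) f x v (h' : R) :
  is_derive (f x) 1 h h' -> differentiable f x ->
  differentiable (h \o f) x /\ 'D_v (h \o f) x = h' * 'D_v f x.
Proof.
move=> [dh <-] df; have dh' := (derivable1_diffP _ _).1 dh.
have dhf : differentiable (h \o f) x by exact: differentiable_comp.
split=> //; rewrite deriveE // [RHS]mulrC deriveE //.
rewrite (@diff_comp _ _ _ _ f h) //= -[X in 'd h _ X]mulr1.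
by rewrite -[_ * 1]/(_ *: 1) linearZ /= -(@deriveE _ _ _ h) // mulrC.
Qed.

End Calculus.

Section FlatFunction.
Context {R : realType}.

(** The classical exp(-1/t), extended by 0, is not closed under differentiation;
the family of all t^(-m) exp(-1/t) is, up to linear combinations, which turns
smoothness into an induction. *)
Definition flat (m : nat) (t : R) : R :=
  if 0 < t then t^-1 ^+ m * expR (- t^-1) else 0.

(** From exp(u) >= u^(m+2) / (m+2)! at u = 1/t.  A quadratic bound is what makes
the derivative at the origin vanish. *)
Lemma flat_le m t : `|flat m t| <= (m.+2)`!%:R * t ^+ 2.
Proof.
rewrite /flat; case: ifPn => t0; last first.
  by rewrite normr0 mulr_ge0 // sqr_ge0.
have i0 : 0 < t^-1 by rewrite invr_gt0.
rewrite ger0_norm; last by rewrite mulr_ge0 ?exprn_ge0 ?expR_ge0 // ltW.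
have h : t^-1 ^+ m.+2 / m.+2`!%:R <= expR t^-1.
  by apply: le_trans (expR_ge1Dxn m.+1 (ltW i0)); rewrite lerDr.
have F0 : 0 < (m.+2)`!%:R :> R by rewrite ltr0n fact_gt0.
rewrite expRN ler_pdivrMr ?expR_gt0 //.
move: h; rewrite ler_pdivrMr // => h.
have -> : t^-1 ^+ m = t ^+ 2 * t^-1 ^+ m.+2.
  by rewrite -[m.+2]addn2 exprD mulrCA -exprMn mulfV ?gt_eqF // expr1n mulr1.
have -> : m.+2`!%:R * t ^+ 2 * expR t^-1
    = t ^+ 2 * (expR t^-1 * m.+2`!%:R) by ring.
by rewrite ler_pM2l ?exprn_gt0.
Qed.

Lemma is_derive_flat m (t : R) :
  is_derive t 1 (flat m) (flat m.+2 t - m%:R * flat m.+1 t).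
Proof.
case: (ltgtP t 0) => [t0|t0|->].
- have -> : flat m.+2 t - m%:R * flat m.+1 t = 0.
    by rewrite /flat ltNge ltW //= mulr0 subr0.
  apply: (@near_eq_is_derive _ _ _ (cst 0)).
    near=> y; rewrite /flat ltNge ltW //=.
    by near: y; exact: lt_nbhsl.
- have t0' : t != 0 by rewrite gt_eqF.
  have dV : is_derive t 1 (fun y : R => y^-1) (- t^-1 ^+ 2).
    apply: is_derive_eq; first exact: is_deriveV.
    by rewrite /GRing.scale /= mulr1 exprVn.
  have dNV := is_deriveN dV.
  have dE := @is_derive1_comp _ _ _ t _ _ (is_derive_expR (- t^-1)) dNV.
  have d := is_deriveM (is_deriveX m dV) dE.
  apply: near_eq_is_derive (is_derive_eq d _).
    near=> y; rewrite /flat ifT; last by near: y; exact: lt_nbhsr.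
    by rewrite mulrfctE exprfctE.
  rewrite exprfctE /flat t0 /GRing.scale /= opprK.
  case: m {d} => [|m] /=.
    by rewrite !expr0; ring.
  by rewrite !exprS; ring.
- have -> : flat m.+2 0 - m%:R * flat m.+1 0 = 0 :> R.
    by rewrite /flat ltxx mulr0 subr0.
  suff cv : h^-1 *: ((flat m \o shift 0) (h *: 1) - flat m 0)
      @[h --> (0 : R)^'] --> (0 : R).
    by apply: DeriveDef; [apply/cvg_ex; exists 0 | exact: cvg_lim].
  apply/cvgr0Pnorm_lt => e e0; near=> h.
  have h0 : 0 < `|h| by rewrite normr_gt0; near: h; exact: nbhs_dnbhs_neq.
  have F0 : 0 < (m.+2)`!%:R :> R by rewrite ltr0n fact_gt0.
  rewrite /= addr0 /GRing.scale /= mulr1 {2}/flat ltxx subr0.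
  rewrite normrM normfV mulrC ltr_pdivrMr //.
  apply: le_lt_trans (flat_le m h) _.
  rewrite -real_normK ?num_real // expr2 mulrA ltr_pM2r // -ltr_pdivlMl //.
  near: h; apply: dnbhs0_lt; by rewrite mulr_gt0 // invr_gt0.
Unshelve. all: by end_near. Qed.

(** The induction on k runs over all m at once, since the derivative of [flat m]
involves [flat m.+1] and [flat m.+2]. *)
Lemma Ck_flat n k m (U : set 'rV[R]_n) (f : 'rV[R]_n -> R) :
  open U -> Ck k U f -> Ck k U (flat m \o f).
Proof.
move=> oU; elim: k m => [|k IH] m hf.
  move=> x Ux; apply: continuous_comp; first exact: hf.
  apply: differentiable_continuous; apply/derivable1_diffP.
  by have [] := is_derive_flat m (f x).
have [f1 f2] := hf; split=> [x Ux|v].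
  by have [] := derive_comp1 0 (is_derive_flat m (f x)) (f1 x Ux).
have ih j := IH j (Ck_le hf).
have := CkM oU (CkB oU (ih m.+2) (CkM oU (Ck_cst k U m%:R) (ih m.+1))) (f2 v).
apply: Ck_ext => // x Ux.
by have [_ ->] := derive_comp1 v (is_derive_flat m (f x)) (f1 x Ux).
Qed.

Definition step (t : R) : R := flat 0 t / (flat 0 t + flat 0 (1 - t)).

Lemma flat_ge0 m t : 0 <= flat m t.
Proof.
rewrite /flat; case: ifP => // /ltW t0.
by rewrite mulr_ge0 ?exprn_ge0 ?invr_ge0 ?expR_ge0.
Qed.

Lemma flat_gt0 m t : 0 < t -> 0 < flat m t.
Proof.
by rewrite /flat => t0; rewrite t0 mulr_gt0 ?exprn_gt0 ?invr_gt0 ?expR_gt0.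
Qed.

Lemma flat_eq0 m t : t <= 0 -> flat m t = 0.
Proof. by rewrite /flat leNgt => /negPf ->. Qed.

Lemma step_eq0 t : t <= 0 -> step t = 0.
Proof. by move=> t0; rewrite /step flat_eq0 // mul0r. Qed.

Lemma step_eq1 t : 1 <= t -> step t = 1.
Proof.
move=> t1; rewrite /step (@flat_eq0 0 (1 - t)) ?subr_le0 // addr0 divff //.
by rewrite gt_eqF // flat_gt0 // (lt_le_trans ltr01).
Qed.

(** One of t and 1 - t is positive. *)
Lemma step_den_neq0 t : flat 0 t + flat 0 (1 - t) != 0.
Proof.
rewrite gt_eqF //; case: (ltP 0 t) => t0.
  by rewrite ltr_pwDl ?flat_gt0 ?flat_ge0.
by rewrite ltr_wpDl ?flat_ge0 ?flat_gt0 // subr_gt0 (le_lt_trans t0).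
Qed.

Lemma Ck_step n k (U : set 'rV[R]_n) (f : 'rV[R]_n -> R) :
  open U -> Ck k U f -> Ck k U (step \o f).
Proof.
move=> oU hf.
have h1 := Ck_flat 0 oU hf.
have h2 := Ck_flat 0 oU (CkB oU (Ck_cst k U 1) hf).
apply: (CkM oU h1 (CkV oU _ (CkD oU h1 h2))) => x _; exact: step_den_neq0.
Qed.

End FlatFunction.

(** * Bump functions on a manifold *)

Section Bump.
Context {R : realType} {n : nat} {M : smooth_manifold R n}.
Implicit Types (W : set M) (f g : M -> R) (x : M).

Lemma smooth_in_local W f :
  (forall x, W x -> exists2 V : set M, V x & smooth_in (V `&` W) f) ->
  smooth_in W f.
Proof.
move=> loc i k; apply: Ck_local => y [cy Wy].
have [V Vy h] := loc _ Wy; exists (param i @^-1` V) => //.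
by apply: Ck_sub (h i k) => z [Vz [cz Wz]].
Qed.

Lemma smooth_in_ext W f g : open W -> (forall x, W x -> f x = g x) ->
  smooth_in W f -> smooth_in W g.
Proof.
move=> oW fg hf i k; have oU := open_param_preimage (i := i) oW.
by apply: (Ck_ext oU _ (hf i k)) => y [_ Wy]; exact: fg.
Qed.

Definition sqdist (c : 'rV[R]_n) (y : 'rV[R]_n) : R :=
  \sum_(k < n) (y 0 k - c 0 k) ^+ 2.

Lemma Ck_sqdist m (U : set 'rV[R]_n) (c : 'rV[R]_n)
    (G : 'rV[R]_n -> 'rV[R]_n) : open U ->
  (forall k, Ck m U (fun y : 'rV[R]_n => G y 0 k)) ->
  Ck m U (fun y => sqdist c (G y)).
Proof.
move=> oU hG; rewrite /sqdist.
suff h (s : seq 'I_n) : Ck m U (fun y => \sum_(k <- s) (G y 0 k - c 0 k) ^+ 2).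
  exact: h.
elim: s => [|k s IH].
  by apply: (Ck_ext oU _ (Ck_cst m U 0)) => y _; rewrite big_nil.
have d := CkB oU (hG k) (Ck_cst m U (c 0 k)).
apply: (Ck_ext oU _ (CkD oU (CkM oU d d) IH)) => y _.
by rewrite big_cons expr2.
Qed.

Lemma sqdist_coord_le (c y : 'rV[R]_n) k : (y 0 k - c 0 k) ^+ 2 <= sqdist c y.
Proof.
by rewrite /sqdist (bigD1 k) //= lerDl sumr_ge0 // => j _; exact: sqr_ge0.
Qed.

(** In a chart, phi is a step function of the squared distance to x.  Its support
is the image of a compact box, hence closed because M is Hausdorff; this is why
the extension by 0 is smooth. *)
Lemma smooth_bump W x : open W -> W x ->
  exists phi : smooth_fun M,
    (exists2 C, closed C /\ C `<=` W & forall y, ~ C y -> phi y = 0) /\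
    \near x, phi x = 1.
Proof.
move=> oW Wx; have [i di] := chart_cover x.
pose y0 := chart i x; have cy0 := chart_domE di.
have oU := open_param_preimage (i := i) oW.
have : nbhs y0 (chart_cod i `&` param i @^-1` W).
  by apply: open_nbhs_nbhs; split=> //; split=> //=; rewrite chartK.
case/nbhs_ballP => e /= e0 eU.
(* phi is 1 at distance less than d and 0 outside the box of half-width 2 d, which
   lies in the ball of radius e = 3 d. *)
pose d := e / 3; have d0 : 0 < d by rewrite /d divr_gt0.
pose K : set 'rV[R]_n :=
  [set y | forall k, `[y0 0 k - 2 * d, y0 0 k + 2 * d] (y 0 k)].
have KU y : K y -> chart_cod i y /\ W (param i y).
  move=> Ky; apply: eU; split=> // a b; rewrite (ord1 a) /ball /=.
  move: (Ky b); rewrite /= in_itv /= => /andP[h1 h2].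
  have e3 : e = 3 * d by rewrite /d; field.
  by rewrite e3 ltr_norml; apply/andP; split; lra.
have cK : compact K.
  apply: (@rV_compact R n (fun k => `[y0 0 k - 2 * d, y0 0 k + 2 * d]%classic)).
  by move=> k; exact: segment_compact.
pose C := param i @` K.
have clC : closed C.
  apply: compact_closed (mspace_hausdorff (s := M)) _.
  apply: continuous_compact cK; apply: continuous_in_subspaceT => y.
  by rewrite inE => /KU[cy _]; exact: param_continuous.
have CW : C `<=` W by move=> _ [y /KU[_ ?] <-].
pose b y := step (2 - sqdist y0 y / d ^+ 2).
have bK y : b y != 0 -> K y.
  move=> by0 k; rewrite /= in_itv /=.
  have q : sqdist y0 y < 2 * d ^+ 2.
    rewrite ltNge; apply/negP => h; case/eqP: by0; apply: step_eq0.
    by rewrite subr_le0 ler_pdivlMr ?exprn_gt0.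
  have := sqdist_coord_le y0 y k => h.
  have : (y 0 k - y0 0 k) ^+ 2 <= (2 * d) ^+ 2 by nra.
  by move=> h2; apply/andP; split; nra.
have b1 y : sqdist y0 y < d ^+ 2 -> b y = 1.
  move=> q; apply: step_eq1.
  by rewrite lerBrDl -lerBrDr ler_pdivrMr ?exprn_gt0 //; lra.
pose phi p := if `[< chart_dom i p >] then b (chart i p) else 0.
have phi0 p : ~ C p -> phi p = 0.
  move=> nC; rewrite /phi; case: asboolP => // dp.
  apply/eqP/negPn/negP => /bK Kp.
  by apply: nC; exists (chart i p) => //; rewrite chartK.
have sphi : smooth_in setT phi.
  apply: smooth_in_local => p _; case: (pselect (chart_dom i p)) => dp.
    exists (chart_dom i) => //; rewrite setIT => j k.
    have oV := open_param_preimage (i := j) (@open_chart_dom _ _ M i).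
    have sq := Ck_sqdist y0 oV (fun l => chart_compat j i l k).
    have := Ck_step oV
      (CkB oV (Ck_cst k _ 2) (CkM oV sq (Ck_cst k _ (d ^+ 2)^-1))).
    apply: Ck_ext => // y [_ /= dy].
    by rewrite /phi; case: asboolP.
  exists (~` C).
    by move=> [y /KU[cy _] e']; apply: dp; rewrite -e'; exact: param_codE.
  rewrite setIT; apply: (smooth_in_ext _ _ (smooth_in_cst _ 0)).
    by apply: closed_openC.
  by move=> y nC; rewrite phi0.
exists (mk_smooth sphi); split; first by exists C.
have n1 : nbhs y0 [set y | sqdist y0 y < d ^+ 2].
  have cq := @Ck_sqdist 0 setT y0 id openT
    (fun k => @Ck_coord _ _ 0 setT k) y0 I.
  apply: (cq [set z | z < d ^+ 2]); rewrite /sqdist big1 => [|k _]; last first.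
    by rewrite subrr expr0n.
  by apply: lt_nbhsl; rewrite exprn_gt0.
have n2 : nbhs x [set p | sqdist y0 (chart i p) < d ^+ 2] :=
  chart_continuous di n1.
have n3 : nbhs x (chart_dom i).
  by apply: open_nbhs_nbhs; split=> //; exact: open_chart_dom.
apply: (filterS2 _ _ n2 n3) => p /= q dp.
by rewrite /phi; case: asboolP => // _; exact: b1.
Qed.

(** A function g that is smooth on W only, once multiplied by a cutoff f, can be
used globally: near a point outside W the product vanishes. *)
Lemma smooth_in_cutoff W W' (C : set M) f g :
  open W -> open W' -> closed C -> C `<=` W ->
  (forall y, ~ C y -> f y = 0) -> smooth_in setT f ->
  smooth_in (W `&` W') g -> smooth_in W' (f * g).
Proof.
move=> oW oW' cC CW f0 sf sg; apply: smooth_in_local => p W'p.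
case: (pselect (W p)) => Wp.
  exists W => //; apply: smooth_inM sg; first exact: openI.
  exact: smooth_in_sub sf.
exists (~` C); first by move=> /CW.
apply: (smooth_in_ext _ _ (smooth_in_cst _ 0)).
  by apply: openI => //; exact: closed_openC.
by move=> y [nC _]; rewrite mulrfctE f0 // mul0r.
Qed.

End Bump.

(** * Sections and covectors *)

Section LocalFrame.
Context {R : realType} {n r : nat} {M : smooth_manifold R n}.
Context {A : vector_bundle M r}.
Local Notation F := (smooth_fun M).
Implicit Types (a b : section A) (f g : F) (al be : covector A).

Lemma smooth_fun_eq (f g : F) : (forall x, f x = g x) -> f = g.
Proof. by move=> fg; apply/val_inj/funext. Qed.

Lemma smooth_funD (f g : F) x : (f + g) x = f x + g x. Proof. by []. Qed.
Lemma smooth_funM (f g : F) x : (f * g) x = f x * g x. Proof. by []. Qed.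
Lemma smooth_fun0 x : (0 : F) x = 0. Proof. by []. Qed.
Definition smooth_funE := (smooth_funD, smooth_funM, smooth_fun0).

Lemma section_sum (I : Type) (s : seq I) (h : I -> section A) x :
  (\sum_(k <- s) h k) x = \sum_(k <- s) h k x.
Proof. by elim: s => [|k s IH]; rewrite ?big_nil // !big_cons -IH. Qed.

(** The equation [g * phi = g] expresses by algebra that phi is constant near x, in
a form to which derivations can be applied. *)
Lemma smooth_bump_absorb (phi : F) x : (\near x, phi x = 1) ->
  exists2 g : F, g x = 1 & g * phi = g.
Proof.
move=> phi1; have [g [[C [_ CV] g0] /nbhs_singleton g1]] :=
  smooth_bump (@open_interior _ [set y | phi y = 1]) phi1.
exists g => //; apply: smooth_fun_eq => p; rewrite smooth_funE.
case: (pselect (C p)) => Cp; last by rewrite g0 // mul0r.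
by have /interior_subset -> := CV _ Cp; rewrite mulr1.
Qed.

(** The function phi is the square of a cutoff supported in a trivialisation: one
factor extends the local frame to M, the other one its dual.  Every use of the
local triviality of A goes through this lemma. *)
Lemma local_frame (x : M) : exists (phi : F) (e : 'I_r -> section A)
    (ep : 'I_r -> covector A),
  (\near x, phi x = 1) /\ forall a, phi *: a = \sum_k ep k a *: e k.
Proof.
have [j dj] := triv_cover A x; pose W : set M := triv_dom j.
have oW : open W by exact: open_triv_dom.
have [psi [[C [cC CW] psi0] psi1]] := smooth_bump oW dj.
(* Outside W, where [v k] takes arbitrary values, psi vanishes. *)
pose v k p : A p := xget 0 [set w : A p | triv j p w = delta_mx 0 k].
have vE k p : W p -> triv j p (v k p) = delta_mx 0 k.
  move=> Wp; rewrite /v; case: xgetP => [w _ //|nw].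
  have [q _ qK] := triv_bij Wp.
  by have := nw (q (delta_mx 0 k)); case; rewrite /= qK.
have se k : smooth_section (fun p => psi p *: v k p).
  move=> i l; have oi := @open_triv_dom _ _ _ _ A i.
  apply: (smooth_in_ext oi
    (f := (psi : M -> R) * (fun p => triv i p (v k p) 0 l))).
    by move=> p _; rewrite linearZ mxE.
  apply: (smooth_in_cutoff oW oi cC CW psi0 (smooth_funP psi)).
  apply: smooth_in_ext (@transition_smooth _ _ _ _ A j i k l).
    by apply: openI.
  by move=> p [Wp ip]; rewrite (transitionE _ Wp ip) vE // -rowE mxE.
have sep k a : smooth_in setT ((psi : M -> R) * (fun p => triv j p (a p) 0 k)).
  apply: (smooth_in_cutoff oW openT cC CW psi0 (smooth_funP psi)).
  rewrite setIT; exact: section_smooth.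
have lep k (f : F) a b : mk_smooth (sep k (f *: a + b))
    = f * mk_smooth (sep k a) + mk_smooth (sep k b).
  apply: smooth_fun_eq => p; rewrite !smooth_funE /= !mulrfctE.
  by rewrite linearD linearZ !mxE mulrDr mulrCA.
exists (psi * psi), (fun k => Section_ (se k)), (fun k => Covector (lep k)).
split; first by apply: filterS psi1 => p p1; rewrite smooth_funE p1 mulr1.
move=> a; apply: section_eq => p; rewrite section_sum.
transitivity ((psi p * psi p) *: a p); first by [].
transitivity (\sum_k (psi p * triv j p (a p) 0 k) *: (psi p *: v k p));
  last by [].
case: (pselect (W p)) => Wp; last first.
  have -> : psi p = 0 by apply: psi0 => /CW.
  by rewrite mul0r scale0r big1 // => k _; rewrite mul0r scale0r.
apply: (bij_inj (triv_bij Wp)); rewrite linearZ linear_sum.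
apply/rowP => l; rewrite summxE mxE (bigD1 l) //= big1 => [|k kl].
  by rewrite addr0 scalerA linearZ /= vE // !mxE !eqxx /=; ring.
by rewrite scalerA linearZ /= vE // !mxE [l == k]eq_sym (negPf kl) andbF mulr0.
Qed.

Lemma covector0r al : al 0 = 0.
Proof.
have := covectorP al 1 0 0; rewrite scale1r addr0 mul1r => h.
by apply: (@addrI _ (al 0)); rewrite addr0 -h.
Qed.

Lemma covectorZr al f a : al (f *: a) = f * al a.
Proof. by have := covectorP al f a 0; rewrite covector0r !addr0. Qed.

Lemma covectorDr al a b : al (a + b) = al a + al b.
Proof. by rewrite -[a in LHS]scale1r covectorP mul1r. Qed.

Lemma covectorNr al a : al (- a) = - al a.
Proof. by rewrite -scaleN1r covectorZr mulN1r. Qed.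

Lemma covector_sum al (I : Type) (s : seq I) (h : I -> section A) :
  al (\sum_(k <- s) h k) = \sum_(k <- s) al (h k).
Proof.
elim: s => [|k s IH]; rewrite ?big_nil ?big_cons.
  by rewrite covector0r.
by rewrite covectorDr IH.
Qed.

Definition covector_linE := (covectorDr, covectorNr, covectorZr).

Lemma section_separated a b : (forall al, al a = al b) -> a = b.
Proof.
move=> ab; apply: section_eq => x.
have [phi [e [ep [/nbhs_singleton phi1 frame]]]] := local_frame x.
have : phi *: a = phi *: b.
  by rewrite !frame; apply: eq_bigr => k _; rewrite ab.
move/(congr1 (fun s : section A => s x)).
change (phi x *: a x = phi x *: b x -> a x = b x).
by rewrite phi1 !scale1r.
Qed.

Lemma dual_frame phi (e : 'I_r -> section A) (ep : 'I_r -> covector A) al :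
  (forall a, phi *: a = \sum_k ep k a *: e k) ->
  phi *: al = \sum_k al (e k) *: ep k.
Proof.
move=> frame; apply: covector_eq => a.
rewrite -[LHS]covectorZr frame covector_sum.
have sumE (s : seq 'I_r) :
    (\sum_(k <- s) al (e k) *: ep k : covector A) a
    = \sum_(k <- s) al (e k) * ep k a.
  by elim: s => [|k s IH]; rewrite ?big_nil // !big_cons -IH.
by rewrite sumE; apply: eq_bigr => k _; rewrite covectorZr mulrC.
Qed.

Lemma covector_linear_sum (t : covector A -> F) :
  (forall f al be, t (f *: al + be) = f * t al + t be) ->
  forall (I : Type) (s : seq I) (f : I -> F) (al : I -> covector A),
  t (\sum_(k <- s) f k *: al k) = \sum_(k <- s) f k * t (al k).
Proof.
move=> tP I s f al; elim: s => [|k s IH].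
  rewrite !big_nil; have := tP 1 0 0; rewrite scale1r addr0 mul1r => h.
  by apply: (@addrI _ (t 0)); rewrite addr0 -h.
by rewrite !big_cons tP IH.
Qed.

(** If phi a = sum_k ep_k(a) e_k, then phi t is the evaluation at
sum_k t(ep_k) e_k.  The sections found in this way around two points agree
wherever both functions phi equal 1, and are glued. *)
Lemma section_representation (t : covector A -> F) :
  (forall f al be, t (f *: al + be) = f * t al + t be) ->
  exists a, forall al, al a = t al.
Proof.
move=> tP.
have loc (x : M) : exists h : F * section A,
    (\near x, h.1 x = 1) /\ forall al, al h.2 = h.1 * t al.
  have [phi [e [ep [phi1 frame]]]] := local_frame x.
  exists (phi, \sum_k t (ep k) *: e k); split=> //= al.
  have phial := dual_frame al frame.
  have : t (phi *: al) = phi * t al.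
    have := covector_linear_sum tP [:: tt] (fun=> phi) (fun=> al).
    by rewrite !big_seq1.
  rewrite phial (covector_linear_sum tP) covector_sum => <-.
  by apply: eq_bigr => k _; rewrite covectorZr mulrC.
have [h hP] := choice loc.
have glue x y : (h x).1 y *: (h y).2 y = (h x).2 y.
  have : (h x).1 *: (h y).2 = (h y).1 *: (h x).2.
    apply: section_separated => al; rewrite !covectorZr (hP x).2 (hP y).2.
    by rewrite mulrCA.
  move/(congr1 (fun s : section A => s y)).
  change ((h x).1 y *: (h y).2 y = (h y).1 y *: (h x).2 y ->
    (h x).1 y *: (h y).2 y = (h x).2 y).
  by rewrite (nbhs_singleton (hP y).1) scale1r.
have sa : smooth_section (fun y => (h y).2 y).
  move=> i k; apply: smooth_in_local => x Wx.
  pose V := [set y | (h x).1 y = 1]°.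
  exists V; first exact: (hP x).1.
  apply: smooth_in_ext (smooth_in_sub _ (section_smooth (h x).2 i k)).
  - by apply: openI; [exact: open_interior|exact: open_triv_dom].
  - by move=> y [/interior_subset V1 _]; rewrite -glue V1 scale1r.
  - by move=> y [].
exists (Section_ sa) => al; apply: smooth_fun_eq => x.
have : (h x).1 *: Section_ sa = (h x).2 by apply: section_eq => y; exact: glue.
move/(congr1 (fun s => al s x)); rewrite covectorZr (hP x).2 !smooth_funE.
by rewrite (nbhs_singleton (hP x).1) !mul1r.
Qed.

Lemma section_ofP (t : covector A -> F) :
  (forall f al be, t (f *: al + be) = f * t al + t be) ->
  forall al, al (section_of t) = t al.
Proof.
move=> /section_representation [a aP] al.
by rewrite /section_of; case: xgetP => [b _ /(_ al) //|/(_ a)].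
Qed.

End LocalFrame.

(** * Calculus on a Lie algebroid *)

Section LieCalculus.
Context {R : realType} {n r : nat} {M : smooth_manifold R n}.
Context {A : vector_bundle M r} (L : lie_algebroid A).
Local Notation F := (smooth_fun M).
Local Notation rho := (anchor_act L).
Local Notation Lie := (lie_covector L).
Local Notation br := (bracket L).
Local Notation d := (d_fun L).
Implicit Types (a b c w : section A) (f g h : F) (al be ga X Y : covector A).

Lemma smooth_cst1 : smooth_cst M 1 = 1. Proof. exact/val_inj. Qed.

Lemma bracketDr a b c : br a (b + c) = br a b + br a c.
Proof. by have := bracket_linearr L 1 a b c; rewrite smooth_cst1 !scale1r. Qed.

Lemma bracketDl a b c : br (a + b) c = br a c + br b c.
Proof. by have := bracket_linearl L 1 a b c; rewrite smooth_cst1 !scale1r. Qed.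

Lemma bracketNr a b : br a (- b) = - br a b.
Proof.
apply/eqP; rewrite -addr_eq0 -bracketDr addNr -(scale0r 0) bracket_leibniz.
by rewrite scale0r scaler0 scale0r addr0.
Qed.

Lemma bracketZl a b f : br (f *: a) b = f *: br a b - rho b f *: a.
Proof. by rewrite bracket_skew bracket_leibniz opprD -scalerN -bracket_skew. Qed.

(** Values are real, so 2 is invertible. *)
Lemma bracket_diag a : br a a = 0.
Proof.
apply: section_separated => X; rewrite covector0r.
have /eqP := congr1 X (bracket_skew L a a); rewrite covector_linE -subr_eq0 opprK.
move=> h; apply: smooth_fun_eq => x; apply/eqP.
move/eqP/(congr1 (fun f : F => f x)): h; rewrite !smooth_funE => /eqP.
by rewrite -mulr2n mulrn_eq0.
Qed.

Lemma anchorDl a b f : rho (a + b) f = rho a f + rho b f.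
Proof. by have := anchor_act_linear L 1 a b f; rewrite scale1r mul1r. Qed.

Lemma anchor0l f : rho 0 f = 0.
Proof. by apply: (@addrI _ (rho 0 f)); rewrite -anchorDl !addr0. Qed.

Lemma anchorZl a f g : rho (f *: a) g = f * rho a g.
Proof. by have := anchor_act_linear L f a 0 g; rewrite anchor0l !addr0. Qed.

Lemma anchor0r a : rho a 0 = 0.
Proof. by apply: (@addrI _ (rho a 0)); rewrite -anchor_actD !addr0. Qed.

Lemma anchorNr a f : rho a (- f) = - rho a f.
Proof. by apply/eqP; rewrite -addr_eq0 -anchor_actD addNr anchor0r. Qed.

Lemma anchor1r a : rho a 1 = 0.
Proof.
apply: (@addrI _ (rho a 1)).
by have := anchor_actM L a 1 1; rewrite !mul1r addr0 => <-.
Qed.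

Definition anchor_actE :=
  (anchor_actD L, anchorNr, anchor_actM L, anchor0r, anchor1r).

Lemma bracket_derivation a b c : br a (br b c) = br (br a b) c + br b (br a c).
Proof.
have := bracket_jacobi L a b c.
rewrite (bracket_skew L c a) (bracket_skew L c (br a b)) bracketNr.
by move/eqP; rewrite -addrA addr_eq0 opprD !opprK addrC => /eqP.
Qed.

(** The anchor is a morphism by the Jacobi identity for a, b and f c: expanded with
the Leibniz rule, it says that the defect h satisfies h c = 0 for every section
c.  Now h is a sum of terms rho(a') g, and h rho(a') g = rho(h a') g = 0; so
h^2 = 0. *)
Lemma anchor_bracket a b f : rho (br a b) f = rho a (rho b f) - rho b (rho a f).
Proof.
pose h := rho (br a b) f - rho a (rho b f) + rho b (rho a f).
have hc c : h *: c = 0.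
  have jac := bracket_derivation a b (f *: c).
  apply: section_separated => al; move/(congr1 al): jac.
  rewrite !bracket_leibniz !bracketDr !bracket_leibniz (bracket_derivation a b c).
  rewrite !covector_linE covector0r /h => jac.
  by move/esym/eqP: jac; rewrite -subr_eq0 => /eqP <-; ring.
have hh a' g : h * rho a' g = 0 by rewrite -anchorZl hc anchor0l.
have h2 : h * h = 0 by rewrite {2}/h mulrDr mulrBr !hh subrr addr0.
suff : h = 0.
  by rewrite /h => /eqP; rewrite addr_eq0 subr_eq => /eqP ->; rewrite addrC.
apply: smooth_fun_eq => x; apply/eqP; rewrite -sqrf_eq0 expr2.
by rewrite -smooth_funM h2.
Qed.

Lemma lieE a al b : Lie a al b = rho a (al b) - al (br a b). Proof. by []. Qed.

Lemma covectorDE al be a : (al + be) a = al a + be a. Proof. by []. Qed.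
Lemma covectorNE al a : (- al) a = - al a. Proof. by []. Qed.
Lemma covectorZE f al a : (f *: al) a = f * al a. Proof. by []. Qed.
Lemma dE f a : d f a = rho a f. Proof. by []. Qed.
Lemma covectorBE al be a : (al - be) a = al a - be a. Proof. by []. Qed.
Definition covectorE := (covectorDE, covectorNE, covectorZE, dE).

Lemma lieD a al be : Lie a (al + be) = Lie a al + Lie a be.
Proof.
by apply: covector_eq => w; rewrite !(lieE, covectorE) anchor_actD; ring.
Qed.

Lemma lieN a al : Lie a (- al) = - Lie a al.
Proof. by apply: covector_eq => w; rewrite !(lieE, covectorE) anchorNr; ring. Qed.

Lemma lieZ a f al : Lie a (f *: al) = f *: Lie a al + rho a f *: al.
Proof.
by apply: covector_eq => w; rewrite !(lieE, covectorE) anchor_actM; ring.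
Qed.

Lemma lie_d a f : Lie a (d f) = d (rho a f).
Proof.
by apply: covector_eq => w; rewrite !(lieE, covectorE) anchor_bracket; ring.
Qed.

Lemma lieZl f a al : Lie (f *: a) al = f *: Lie a al + al a *: d f.
Proof.
apply: covector_eq => w.
by rewrite !(lieE, covectorE) bracketZl anchorZl !covector_linE; ring.
Qed.

Lemma lieDl a b al : Lie (a + b) al = Lie a al + Lie b al.
Proof.
apply: covector_eq => w; rewrite !(lieE, covectorE) bracketDl anchorDl.
by rewrite !covector_linE; ring.
Qed.

Lemma lie_bracket a b al : Lie (br a b) al = Lie a (Lie b al) - Lie b (Lie a al).
Proof.
apply: covector_eq => w.
rewrite !(lieE, covectorE) !(anchor_bracket, anchor_actE).
rewrite (_ : al (br (br a b) w) = al (br a (br b w)) - al (br b (br a w))).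
  by ring.
by rewrite (bracket_derivation a b w) covector_linE addrK.
Qed.

End LieCalculus.

(** * The Koszul bracket of a bivector field *)

Section KoszulBracket.
Context {R : realType} {n r : nat} {M : smooth_manifold R n}.
Context {A : vector_bundle M r} (L : lie_algebroid A).
Local Notation F := (smooth_fun M).
Local Notation rho := (anchor_act L).
Local Notation Lie := (lie_covector L).
Local Notation br := (bracket L).
Local Notation d := (d_fun L).
Implicit Types (a b c w : section A) (f g h : F) (al be ga X Y : covector A).
Context (Pi : multivec A) (hPi : is_multivec 2 Pi).
Local Notation sh := (sharp Pi).
Local Notation K := (koszul L Pi).

Lemma lie_bivectorE a al be : lie_multivec L a Pi [:: al; be]
  = rho a (Pi [:: al; be]) - (Pi [:: Lie a al; be] + Pi [:: al; Lie a be]).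
Proof. by rewrite /lie_multivec /= !big_ord_recl big_ord0 addr0. Qed.

Lemma bivector_skew al be : Pi [:: al; be] = - Pi [:: be; al].
Proof.
have [_ lin alt] := hPi; apply/eqP; rewrite -addr_eq0.
(* The coefficient 1 puts al + be in the shape of the linearity rule. *)
have := alt [::] [::] [::] (1 *: al + be).
rewrite /= (lin [::]) (lin [:: al]) (lin [:: be]).
by rewrite (alt [::] [::] [::]) (alt [::] [::] [::]) !mul1r add0r addr0 => ->.
Qed.

Lemma sharpE al be : be (sh al) = Pi [:: al; be].
Proof.
by apply: section_ofP => f X Y; have [_ lin _] := hPi; exact: (lin [:: al]).
Qed.

Lemma sharp_skew al be : be (sh al) = - al (sh be).
Proof. by rewrite !sharpE bivector_skew. Qed.

Lemma sharpZ f al : sh (f *: al) = f *: sh al.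
Proof.
apply: section_separated => X.
by rewrite covector_linE !(sharp_skew _ X) covectorE; ring.
Qed.

Lemma bivectorZl f X Y : Pi [:: f *: X; Y] = f * Pi [:: X; Y].
Proof. by rewrite -!sharpE sharpZ covector_linE. Qed.

Lemma bivectorDl X Y Z : Pi [:: X + Y; Z] = Pi [:: X; Z] + Pi [:: Y; Z].
Proof.
by have [_ lin _] := hPi; rewrite -[X in LHS]scale1r (lin [::]) mul1r.
Qed.

(** Half of the Schouten square of Pi, as [schouten_squareE] shows. *)
Definition poisson_defect al be ga : F := cyclic_sum (fun X Y Z : covector A =>
  rho (sh Z) (Pi [:: X; Y]) - X (br (sh Y) (sh Z))) al be ga.

Lemma poisson_defectC al be ga :
  poisson_defect al be ga = poisson_defect be ga al.
Proof. by rewrite /poisson_defect /cyclic_sum; ring. Qed.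

Lemma koszulE al be w : K al be w
  = rho (sh al) (be w) - be (br (sh al) w) - rho (sh be) (al w)
    + al (br (sh be) w) - rho w (Pi [:: al; be]).
Proof. by rewrite /koszul !covectorE !lieE; ring. Qed.

(** The defect is what prevents # from being a morphism for the Koszul bracket. *)
Lemma sharp_koszul al be ga :
  ga (sh (K al be)) = ga (br (sh al) (sh be)) + poisson_defect al be ga.
Proof.
rewrite sharp_skew koszulE /poisson_defect /cyclic_sum.
rewrite (bracket_skew L (sh al) (sh ga)) covector_linE !sharpE.
rewrite (bivector_skew ga be) anchorNr; ring.
Qed.

Lemma koszul_skew X Y : K X Y = - K Y X.
Proof.
apply: covector_eq => w.
by rewrite covectorE !koszulE (bivector_skew X) anchorNr; ring.
Qed.

Lemma koszulZl f X ga : K (f *: X) ga = f *: K X ga - rho (sh ga) f *: X.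
Proof.
apply: covector_eq => w; rewrite !(koszulE, covectorE) sharpZ anchorZl.
rewrite bracketZl !covector_linE -!sharpE sharpZ covector_linE !anchor_actM; ring.
Qed.

Lemma koszulDl X Y ga : K (X + Y) ga = K X ga + K Y ga.
Proof.
have shD : sh (X + Y) = sh X + sh Y.
  apply: section_separated => Z.
  by rewrite covector_linE !(sharp_skew _ Z) covectorE; ring.
apply: covector_eq => w; rewrite !(koszulE, covectorE) shD anchorDl.
by rewrite bracketDl !covector_linE -!sharpE shD covector_linE !anchor_actD; ring.
Qed.

(** Since #[X, Y] = [#X, #Y] + C(X, Y), the double bracket consists of iterated Lie
derivatives along #X, #Y and #Z, which cancel cyclically, of L_C(X,Y) Z, and of
the differential of #Z . Pi(X, Y) - Z([#X, #Y]) - Z(C(X, Y)).  The first two of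
these three functions add up to the defect and the last one to three times the
defect, whence the factor -2. *)
Lemma koszul_jacobi (C : covector A -> covector A -> section A) al be ga :
  (forall X Y Z : covector A, Z (C X Y) = poisson_defect X Y Z) ->
  cyclic_sum (fun X Y Z => K (K X Y) Z) al be ga
  = cyclic_sum (fun X Y Z => Lie (C X Y) Z) al be ga
    - d (2 * poisson_defect al be ga).
Proof.
move=> CE.
have shK X Y : sh (K X Y) = br (sh X) (sh Y) + C X Y.
  by apply: section_separated => Z; rewrite covector_linE CE sharp_koszul.
have KK X Y Z : K (K X Y) Z
    = Lie (sh X) (Lie (sh Y) Z) - Lie (sh Y) (Lie (sh X) Z) + Lie (C X Y) Z
      - Lie (sh Z) (Lie (sh X) Y) + Lie (sh Z) (Lie (sh Y) X)
      + d (rho (sh Z) (Pi [:: X; Y]) - Z (br (sh X) (sh Y)) - Z (C X Y)).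
  rewrite {1}/koszul shK -sharpE shK covector_linE lieDl lie_bracket.
  rewrite {1}/koszul !lieD !lieN lie_d.
  by apply: covector_eq => w; rewrite !covectorE !anchor_actE; ring.
rewrite {1}/cyclic_sum !KK !CE.
rewrite (poisson_defectC ga) (poisson_defectC be) {2}/poisson_defect /cyclic_sum.
apply: covector_eq => w; rewrite !covectorE !anchor_actE.
ring.
Qed.

End KoszulBracket.

(** * The twisted bracket *)

Section TwistedBracket.
Context {R : realType} {n r : nat} {M : smooth_manifold R n}.
Context {A : vector_bundle M r} (L : lie_algebroid A).
Local Notation F := (smooth_fun M).
Local Notation rho := (anchor_act L).
Local Notation Lie := (lie_covector L).
Local Notation br := (bracket L).
Local Notation d := (d_fun L).
Implicit Types (a b c w : section A) (f g h : F) (al be ga X Y Z : covector A).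
Context (Pi : multivec A) (hPi : is_multivec 2 Pi).
Context (xi : section A) (lam : covector A).
Local Notation sh := (sharp Pi).
Local Notation K := (koszul L Pi).
Local Notation tw := (twisted_bracket L Pi xi lam).
Local Notation LPi := (lie_multivec L xi Pi).

(** For the Koszul bracket, the differential of the 1-cochain al |-> al(xi) is minus
the Lie derivative of Pi along xi. *)
Lemma koszul_pairing al be :
  K al be xi = rho (sh al) (be xi) - rho (sh be) (al xi) + LPi [:: al; be].
Proof.
rewrite koszulE lie_bivectorE (bivector_skew hPi (Lie _ _)) -!(sharpE hPi) !lieE.
rewrite (bracket_skew L xi (sh al)) (bracket_skew L xi (sh be)) !covector_linE.
by rewrite !(sharpE hPi) (bivector_skew hPi be) anchorNr; ring.
Qed.

(** The section #Z + Z(xi) xi acts as the anchor of the twisted bracket. *)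
Lemma twisted_bracketZl f X Z :
  tw (f *: X) Z = f *: tw X Z - (rho (sh Z) f + Z xi * rho xi f) *: X.
Proof.
rewrite /twisted_bracket (koszulZl L hPi) lieZ (bivectorZl hPi).
by apply: covector_eq => w; rewrite !covectorE; ring.
Qed.

Lemma twisted_bracketDl X Y Z : tw (X + Y) Z = tw X Z + tw Y Z.
Proof.
rewrite /twisted_bracket (koszulDl L hPi) lieD (bivectorDl hPi).
by apply: covector_eq => w; rewrite !covectorE; ring.
Qed.

Lemma twisted_bracketE X Y w : tw X Y w = K X Y w + X xi * (Lie xi Y w - Y w)
  - Y xi * (Lie xi X w - X w) - Pi [:: X; Y] * lam w.
Proof. by []. Qed.

Lemma twisted_bracket_def X Y : tw X Y = K X Y + X xi *: (Lie xi Y - Y)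
  - Y xi *: (Lie xi X - X) - Pi [:: X; Y] *: lam.
Proof. by []. Qed.

Lemma twisted_bracketNl X Z : tw (- X) Z = - tw X Z.
Proof.
rewrite -scaleN1r twisted_bracketZl !anchorNr !anchor1r.
by apply: covector_eq => w; rewrite !covectorE; ring.
Qed.

Lemma twisted_bracket_combination X f Y g Z h Z' ga w :
  tw (X + f *: Y - g *: Z - h *: Z') ga w = tw X ga w
    + (f * tw Y ga w - (rho (sh ga) f + ga xi * rho xi f) * Y w)
    - (g * tw Z ga w - (rho (sh ga) g + ga xi * rho xi g) * Z w)
    - (h * tw Z' ga w - (rho (sh ga) h + ga xi * rho xi h) * Z' w).
Proof.
rewrite (twisted_bracketDl (X + f *: Y - g *: Z) (- (h *: Z')) ga).
rewrite (twisted_bracketDl (X + f *: Y) (- (g *: Z)) ga).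
rewrite (twisted_bracketDl X (f *: Y) ga).
rewrite (twisted_bracketNl (g *: Z) ga) (twisted_bracketNl (h *: Z') ga).
rewrite (twisted_bracketZl f Y ga) (twisted_bracketZl g Z ga).
by rewrite (twisted_bracketZl h Z' ga).
Qed.

Lemma twisted_bracket_lieB X Y w : tw (Lie xi X - X) Y w =
  K (Lie xi X) Y w - K X Y w + (rho xi (X xi) - X xi) * (Lie xi Y w - Y w)
  - Y xi * (Lie xi (Lie xi X) w - 2 * Lie xi X w + X w)
  - (Pi [:: Lie xi X; Y] - Pi [:: X; Y]) * lam w.
Proof.
rewrite (twisted_bracketDl (Lie xi X) (- X) Y) (twisted_bracketNl X Y).
rewrite covectorDE covectorNE (twisted_bracketE (Lie xi X) Y w).
rewrite (twisted_bracketE X Y w); have -> : Lie xi X xi = rho xi (X xi).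
  by rewrite lieE bracket_diag covector0r subr0.
ring.
Qed.

(** The four summands of the inner bracket are treated one by one; the coefficient
of [lam w] uses Pi([X, Y]_Pi, Z) = Z([#X, #Y]) + defect, and that of L_xi Z - Z
uses [koszul_pairing]. *)
Lemma twisted_bracket_twice X Y Z w : tw (tw X Y) Z w =
  K (K X Y) Z w
  + (rho (sh X) (Y xi) - rho (sh Y) (X xi) + LPi [:: X; Y]) * (Lie xi Z w - Z w)
  - Z xi * (Lie xi (K X Y) w - K X Y w)
  - (Z (br (sh X) (sh Y)) + poisson_defect L Pi X Y Z) * lam w
  + X xi * (K (Lie xi Y) Z w - K Y Z w
      + (rho xi (Y xi) - Y xi) * (Lie xi Z w - Z w)
      - Z xi * (Lie xi (Lie xi Y) w - 2 * Lie xi Y w + Y w)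
      - (Pi [:: Lie xi Y; Z] - Pi [:: Y; Z]) * lam w)
  - (rho (sh Z) (X xi) + Z xi * rho xi (X xi)) * (Lie xi Y w - Y w)
  - Y xi * (K (Lie xi X) Z w - K X Z w
      + (rho xi (X xi) - X xi) * (Lie xi Z w - Z w)
      - Z xi * (Lie xi (Lie xi X) w - 2 * Lie xi X w + X w)
      - (Pi [:: Lie xi X; Z] - Pi [:: X; Z]) * lam w)
  + (rho (sh Z) (Y xi) + Z xi * rho xi (Y xi)) * (Lie xi X w - X w)
  - Pi [:: X; Y] * tw lam Z w
  + (rho (sh Z) (Pi [:: X; Y]) + Z xi * rho xi (Pi [:: X; Y])) * lam w.
Proof.
rewrite (twisted_bracket_def X Y).
rewrite (twisted_bracket_combination (K X Y) (X xi) (Lie xi Y - Y)).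
rewrite (twisted_bracket_lieB X Z w) (twisted_bracket_lieB Y Z w).
rewrite (covectorBE (Lie xi X) X w) (covectorBE (Lie xi Y) Y w).
rewrite (twisted_bracketE (K X Y) Z w) (koszul_pairing X Y).
rewrite -(sharpE hPi (K X Y)) (sharp_koszul L hPi); ring.
Qed.

Lemma koszul_lieE X Y w :
  K X Y w = Lie (sh X) Y w - Lie (sh Y) X w - rho w (Pi [:: X; Y]).
Proof. by []. Qed.

Lemma lie_koszulE X Y w : lie_koszul L xi Pi X Y w =
  Lie xi (K X Y) w - K (Lie xi X) Y w + K (Lie xi Y) X w.
Proof.
transitivity (Lie xi (K X Y) w - K (Lie xi X) Y w - K X (Lie xi Y) w);
  first by [].
by rewrite (koszul_skew L hPi X (Lie xi Y)) (covectorNE (K (Lie xi Y) X)) opprK.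
Qed.

(** The value of xi /\ Pi on three covectors. *)
Definition wedge_bivector X Y Z : F :=
  cyclic_sum (fun a b c : covector A => a xi * Pi [:: b; c]) X Y Z.

(** Here T is C minus (xi /\ Pi)(X, Y, .) = X(xi) #Y - Y(xi) #X + Pi(X, Y) xi, and
L_(f a) Z = f L_a Z + Z(a) df. *)
Lemma lie_contraction (C T : covector A -> covector A -> section A) X Y Z w :
  (forall X Y Z : covector A, Z (C X Y) = poisson_defect L Pi X Y Z) ->
  (forall X Y Z : covector A,
     Z (T X Y) = poisson_defect L Pi X Y Z - wedge_bivector X Y Z) ->
  Lie (T X Y) Z w = Lie (C X Y) Z w
    - (X xi * Lie (sh Y) Z w + Pi [:: Y; Z] * rho w (X xi))
    + (Y xi * Lie (sh X) Z w + Pi [:: X; Z] * rho w (Y xi))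
    - (Pi [:: X; Y] * Lie xi Z w + Z xi * rho w (Pi [:: X; Y])).
Proof.
move=> hC hT.
have -> : T X Y = C X Y + (- X xi) *: sh Y + Y xi *: sh X
    + (- Pi [:: X; Y]) *: xi.
  apply: section_separated => V; rewrite hT !covector_linE hC !(sharpE hPi).
  rewrite /wedge_bivector /cyclic_sum.
  by rewrite (bivector_skew hPi V X); ring.
rewrite !lieDl !lieZl !(sharpE hPi).
transitivity (Lie (C X Y) Z w
  + (- X xi * Lie (sh Y) Z w + Pi [:: Y; Z] * rho w (- X xi))
  + (Y xi * Lie (sh X) Z w + Pi [:: X; Z] * rho w (Y xi))
  + (- Pi [:: X; Y] * Lie xi Z w + Z xi * rho w (- Pi [:: X; Y]))); first by [].
by rewrite !anchorNr; ring.
Qed.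

(** The terms - ga(xi) L_xi [al, be]_Pi, ga(xi) [L_xi al, be]_Pi and
ga(xi) [al, L_xi be]_Pi form [lie_koszul].  What is left over,
- ga(xi) [al, be]_Pi, is expanded into Lie derivatives and compared with
[lie_contraction]; the double Koszul brackets are replaced by
[koszul_jacobi]. *)
Lemma twisted_jacobiator (C T : covector A -> covector A -> section A)
    al be ga S :
  (forall X Y Z : covector A, Z (C X Y) = poisson_defect L Pi X Y Z) ->
  (forall X Y Z : covector A,
     Z (T X Y) = poisson_defect L Pi X Y Z - wedge_bivector X Y Z) ->
  S = 2 * wedge_bivector al be ga - 2 * poisson_defect L Pi al be ga ->
  jacobiator L Pi xi lam al be ga
  = cyclic_sum (fun a b c : covector A => Lie (T a b) c) al be ga
    + (S + cyclic_sum (fun a b c : covector A => c xi * LPi [:: a; b]) al be ga)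
      *: lam
    + d S
    - cyclic_sum (fun a b c : covector A => c xi *: lie_koszul L xi Pi a b)
        al be ga
    + cyclic_sum (fun a b c : covector A => LPi [:: a; b] *: (Lie xi c - c))
        al be ga
    + cyclic_sum (fun a b c : covector A =>
          Pi [:: a; b] *: (Lie xi c - tw lam c)) al be ga.
Proof.
move=> hC hT ->; apply: covector_eq => w.
pose evS := 2 * wedge_bivector al be ga - 2 * poisson_defect L Pi al be ga.
pose s := cyclic_sum (fun a b c : covector A => c xi * LPi [:: a; b]) al be ga.
transitivity (tw (tw al be) ga w + tw (tw be ga) al w + tw (tw ga al) be w);
  first by [].
(* Both sides are evaluated at an arbitrary section w. *)
transitivity ((Lie (T al be) ga w + Lie (T be ga) al w + Lie (T ga al) be w)
  + (evS + s) * lam w + rho w evS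
  - (ga xi * lie_koszul L xi Pi al be w + al xi * lie_koszul L xi Pi be ga w
     + be xi * lie_koszul L xi Pi ga al w)
  + (LPi [:: al; be] * (Lie xi ga w - ga w)
     + LPi [:: be; ga] * (Lie xi al w - al w)
     + LPi [:: ga; al] * (Lie xi be w - be w))
  + (Pi [:: al; be] * (Lie xi ga w - tw lam ga w)
     + Pi [:: be; ga] * (Lie xi al w - tw lam al w)
     + Pi [:: ga; al] * (Lie xi be w - tw lam be w))); last by [].
rewrite (twisted_bracket_twice al be ga w) (twisted_bracket_twice be ga al w).
rewrite (twisted_bracket_twice ga al be w).
rewrite (lie_contraction al be ga w hC hT) (lie_contraction be ga al w hC hT).
rewrite (lie_contraction ga al be w hC hT).
rewrite (lie_koszulE al be w) (lie_koszulE be ga w) (lie_koszulE ga al w).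
have jac := koszul_jacobi hPi al be ga hC.
have {}jac : K (K al be) ga w + K (K be ga) al w + K (K ga al) be w
    = Lie (C al be) ga w + Lie (C be ga) al w + Lie (C ga al) be w
      - rho w (2 * poisson_defect L Pi al be ga).
  exact: (congr1 (fun X : covector A => X w) jac).
have -> : K (K al be) ga w
    = Lie (C al be) ga w + Lie (C be ga) al w + Lie (C ga al) be w
      - rho w (2 * poisson_defect L Pi al be ga)
      - K (K be ga) al w - K (K ga al) be w.
  by rewrite -jac; ring.
rewrite /evS /s /wedge_bivector /cyclic_sum.
(* From here on, both sides are put in terms of the same functions: the order of
   the arguments is normalised by skew-symmetry. *)
have PL X Y : Pi [:: X; Lie xi Y] = - Pi [:: Lie xi Y; X].
  exact: bivector_skew.
rewrite (lie_bivectorE L Pi xi al be) (lie_bivectorE L Pi xi be ga).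
rewrite (lie_bivectorE L Pi xi ga al).
rewrite (PL al be) (PL be ga) (PL ga al).
have Kas X Y : K Y X w = - K X Y w by rewrite [in LHS](koszul_skew L hPi).
rewrite (Kas ga al) (Kas be ga) (Kas al be).
rewrite (koszul_lieE al be w) (koszul_lieE be ga w) (koszul_lieE ga al w).
rewrite (bivector_skew hPi al ga) (bivector_skew hPi be al).
rewrite (bivector_skew hPi ga be).
rewrite (poisson_defectC L Pi ga al be) (poisson_defectC L Pi be ga al).
rewrite /poisson_defect /cyclic_sum !anchor_actE.
ring.
Qed.

End TwistedBracket.

(** * Exterior products in low degree *)

Section Wedge.
Context {R : realType} {n r : nat} {M : smooth_manifold R n}.
Context {A : vector_bundle M r}.
Local Notation F := (smooth_fun M).
Implicit Types (a b c : section A) (f g : F) (X Y Z : covector A).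
Implicit Types (P Q : multivec A).

Lemma big_tuple_cons m (G : m.+1.-tuple bool -> F) :
  \sum_(t : m.+1.-tuple bool) G t
  = \sum_(t : m.-tuple bool) G [tuple of true :: t]
    + \sum_(t : m.-tuple bool) G [tuple of false :: t].
Proof.
rewrite (reindex (fun p : bool * m.-tuple bool => [tuple of p.1 :: p.2])) /=.
  rewrite -(pair_bigA _
    (fun (v : bool) (t : m.-tuple bool) => G [tuple of v :: t])).
  by rewrite big_bool.
exists (fun t => (thead t, [tuple of behead t])) => [[b t] _|t _] /=.
  by congr (_, _); apply: val_inj.
by rewrite [RHS]tuple_eta.
Qed.

(** A first argument passed to the second factor is inverted with every argument
passed to the first factor. *)
Lemma shuffle_inv_cons m (v : bool) (t : m.-tuple bool) :
  shuffle_inv [tuple of v :: t] = ((~~ v) * count id t + shuffle_inv t)%N.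
Proof.
rewrite /shuffle_inv big_ord_recl; congr (_ + _)%N.
  rewrite big_mkcond big_ord_recl /= add0n.
  rewrite -sum1_count big_tuple big_distrr /= [RHS]big_mkcond.
  apply: eq_bigr => i _; rewrite !(tnth_nth false) /=.
  by case: v; case: (nth _ t i).
apply: eq_bigr => i _; rewrite big_mkcond big_ord_recl /= add0n [RHS]big_mkcond.
by apply: eq_bigr => j _; rewrite !(tnth_nth false).
Qed.

Lemma mv_wedge_nil P Q : mv_wedge P Q [::] = P [::] * Q [::].
Proof.
rewrite /mv_wedge (bigD1 [tuple]) //= big1 => [|t]; last by rewrite tuple0.
by rewrite /shuffle_inv big_ord0 addr0 mul1r.
Qed.

(** The shuffles are split according to the factor which receives X; to reach the
second factor, X crosses the k arguments of P. *)
Lemma mv_wedge_cons k P Q X s : (forall t, size t != k -> P t = 0) ->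
  mv_wedge P Q (X :: s) = mv_wedge (fun t => P (X :: t)) Q s
    + (-1) ^+ k * mv_wedge P (fun t => Q (X :: t)) s.
Proof.
move=> degP; rewrite /mv_wedge big_tuple_cons; congr (_ + _).
  by apply: eq_bigr => t _; rewrite shuffle_inv_cons mul0n.
rewrite big_distrr /=; apply: eq_bigr => t _; rewrite shuffle_inv_cons mul1n.
have [e|ne] := eqVneq (size (mask t s)) k.
  rewrite size_mask ?size_tuple // in e.
  by rewrite e exprD !mulrA.
by rewrite (degP _ ne); ring.
Qed.

Lemma mv_wedge0l Q s : mv_wedge (fun=> 0) Q s = 0.
Proof. by rewrite /mv_wedge big1 // => t _; rewrite mulr0 mul0r. Qed.

Lemma mv_wedge_fun f Q s : mv_wedge (mv_fun f) Q s = f * Q s.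
Proof.
elim: s Q => [|X s IH] Q; first by rewrite mv_wedge_nil.
rewrite (@mv_wedge_cons 0) => [|[]//].
by rewrite mv_wedge0l add0r expr0 mul1r IH.
Qed.

Lemma mv_wedge_deg1 P Q X s : (forall t, size t != 1%N -> P t = 0) ->
  mv_wedge P Q (X :: s) = P [:: X] * Q s - mv_wedge P (fun t => Q (X :: t)) s.
Proof.
move=> degP; rewrite (mv_wedge_cons _ _ _ degP) expr1 mulN1r; congr (_ - _).
rewrite -mv_wedge_fun; congr (mv_wedge _ _ _); apply/funext => -[|Y t] //=.
by rewrite degP.
Qed.

Lemma mv_wedge12 P Q X Y Z : (forall t, size t != 1%N -> P t = 0) ->
  mv_wedge P Q [:: X; Y; Z]
  = P [:: X] * Q [:: Y; Z] - P [:: Y] * Q [:: X; Z] + P [:: Z] * Q [:: X; Y].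
Proof.
move=> degP; rewrite !mv_wedge_deg1 // mv_wedge_nil (degP [::]) //; ring.
Qed.

Lemma mv_wedge11 P Q X Y : (forall t, size t != 1%N -> P t = 0) ->
  mv_wedge P Q [:: X; Y] = P [:: X] * Q [:: Y] - P [:: Y] * Q [:: X].
Proof.
move=> degP; rewrite !mv_wedge_deg1 // mv_wedge_nil (degP [::]) //; ring.
Qed.

Lemma mv_wedge10 P f X : (forall t, size t != 1%N -> P t = 0) ->
  mv_wedge P (mv_fun f) [:: X] = P [:: X] * f.
Proof.
move=> degP; rewrite !mv_wedge_deg1 // mv_wedge_nil (degP [::]) //=; ring.
Qed.

Lemma mv_wedge21 P Q X Y Z : (forall t, size t != 2 -> P t = 0) ->
  mv_wedge P Q [:: X; Y; Z]
  = P [:: X; Y] * Q [:: Z] - P [:: X; Z] * Q [:: Y] + P [:: Y; Z] * Q [:: X].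
Proof.
move=> degP; rewrite (mv_wedge_cons _ _ _ degP) mv_wedge11 => [|t nt]; last first.
  exact: degP.
rewrite (@mv_wedge_cons 2 P _ Y [:: Z] degP) (@mv_wedge_cons 2 P _ Z [::] degP).
rewrite mv_wedge_deg1; last by move=> t nt; exact: degP.
by rewrite !mv_wedge_nil (degP [:: Y]) // (degP [:: Z]) // (degP [::]) //; ring.
Qed.

Lemma mv_wedge_degree k l P Q s :
  (forall t, size t != k -> P t = 0) -> (forall t, size t != l -> Q t = 0) ->
  size s != (k + l)%N -> mv_wedge P Q s = 0.
Proof.
move=> degP degQ ns; rewrite /mv_wedge big1 // => t _.
have [ek|/degP->] := eqVneq (size (mask t s)) k; last by rewrite mulr0 mul0r.
have [el|/degQ->] := eqVneq (size (mask (map negb t) s)) l; last by rewrite mulr0.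
rewrite !size_mask ?size_map ?size_tuple // in ek el.
move/eqP: ns; case; rewrite -ek -el count_map -[LHS](size_tuple t).
by rewrite -(count_predC id t).
Qed.

End Wedge.

Section BasicMultivectors.
Context {R : realType} {n r : nat} {M : smooth_manifold R n}.
Context {A : vector_bundle M r}.
Local Notation F := (smooth_fun M).
Implicit Types (a b c : section A) (f g : F) (X Y Z : covector A).
Implicit Types (P Q : multivec A).

Lemma mv_section_deg a t : size t != 1%N -> mv_section a t = 0.
Proof. by case: t => [|X []]. Qed.

Lemma is_multivec_fun f : is_multivec 0 (mv_fun f : multivec A).
Proof.
split=> [[]//|s1 s2 g X Y|s1 s2 s3 X].
  by case: s1 => [|? ?] /=; rewrite mulr0 addr0.
by case: s1.
Qed.

Lemma is_multivec_section a : is_multivec 1 (mv_section a).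
Proof.
split=> [|s1 s2 g X Y|s1 s2 s3 X]; first exact: mv_section_deg.
  case: s1 s2 => [|? [|? ?]] [|? ?] //=; by rewrite ?mulr0 ?addr0.
by case: s1 s2 => [|? [|? ?]] [|? ?].
Qed.

Lemma is_multivec_sectionM a b :
  is_multivec 2 (mv_wedge (mv_section a) (mv_section b)).
Proof.
pose B : multivec A :=
  fun s => if s is [:: X; Y] then X a * Y b - Y a * X b else 0.
have -> : mv_wedge (mv_section a) (mv_section b) = B.
  apply/funext => s; have [e|ns] := eqVneq (size s) 2.
    case: s e => [|X [|Y []]] // _; rewrite mv_wedge11 //; exact: mv_section_deg.
  rewrite (mv_wedge_degree (k := 1) (l := 1)) //; try exact: mv_section_deg.
  by case: s ns => [|X [|Y []]].
split=> [s|s1 s2 f X Y|s1 s2 s3 X].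
- by case: s => [|X [|Y []]].
- case: s1 s2 => [|? [|? [|? ?]]] [|? [|? ?]] /=; rewrite ?mulr0 ?addr0 //;
    ring.
- by case: s1 s2 s3 => [|? [|? [|? ?]]] [|? [|? ?]] [|? ?] //=; rewrite ?subrr.
Qed.

Lemma is_multivecD k P Q : is_multivec k P -> is_multivec k Q ->
  is_multivec k (fun s => P s + Q s).
Proof.
move=> [P1 P2 P3] [Q1 Q2 Q3]; split=> [s ns|s1 s2 f X Y|s1 s2 s3 X].
- by rewrite P1 ?Q1 ?addr0.
- by rewrite P2 Q2; ring.
- by rewrite P3 Q3 addr0.
Qed.

Lemma is_multivec0 k : is_multivec k ((fun=> 0) : multivec A).
Proof. by split=> // *; rewrite mulr0 addr0. Qed.

Lemma is_multivec_sum k (I : Type) (s : seq I) (Q : I -> multivec A) :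
  (forall i, is_multivec k (Q i)) -> is_multivec k (fun t => \sum_(i <- s) Q i t).
Proof.
move=> hQ; elim: s => [|i s IH].
  rewrite (_ : (fun t => _) = fun=> 0); first exact: is_multivec0.
  by apply/funext => t; rewrite big_nil.
rewrite (_ : (fun t => _) = fun t => Q i t + \sum_(j <- s) Q j t).
  exact: is_multivecD.
by apply/funext => t; rewrite big_cons.
Qed.

End BasicMultivectors.


(** * The Schouten square of a bivector field *)

Section SchoutenSquare.
Context {R : realType} {n r : nat} {M : smooth_manifold R n}.
Context {A : vector_bundle M r} (L : lie_algebroid A) (sn : schouten_bracket L).
Local Notation F := (smooth_fun M).
Local Notation rho := (anchor_act L).
Local Notation Lie := (lie_covector L).
Local Notation br := (bracket L).
Implicit Types (a b c : section A) (f g : F) (X Y Z : covector A).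
Implicit Types (P Q : multivec A).

(** With g phi = g, the Leibniz rule gives delta g = g delta(phi) + phi delta(g); at
x, where g and phi are 1, this reads delta(phi) = 0. *)
Lemma derivation_local (delta : F -> F) (phi : F) (x : M) :
  (forall f g, delta (f * g) = f * delta g + g * delta f) ->
  (\near x, phi x = 1) -> delta phi x = 0.
Proof.
move=> leib phi1; have [g g1 gphi] := smooth_bump_absorb phi1.
have := congr1 (fun f : F => f x) (leib g phi); rewrite gphi !smooth_funE g1.
rewrite (nbhs_singleton phi1) !mul1r => /eqP.
by rewrite -subr_eq0 opprD addrCA subrr addr0 oppr_eq0 => /eqP.
Qed.

Lemma schouten0 k P s : is_multivec k P -> sn P (fun=> 0) s = 0 :> F.
Proof.
move=> hP; have h := is_multivec0 (A := A) 0.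
have := schouten_linearr sn 1 hP h h s.
rewrite smooth_cst1 (_ : (fun t => _) = fun=> 0).
  by rewrite mul1r => e; apply: (@addrI _ (sn P (fun=> 0) s)); rewrite addr0 -e.
by apply/funext => t; rewrite mulr0 addr0.
Qed.

Lemma schouten_sum k l P (I : Type) (s : seq I) (Q : I -> multivec A) t :
  is_multivec k P -> (forall i, is_multivec l (Q i)) ->
  sn P (fun u => \sum_(i <- s) Q i u) t = \sum_(i <- s) sn P (Q i) t.
Proof.
move=> hP hQ; elim: s => [|i s IH].
  rewrite big_nil (_ : (fun u => _) = fun=> 0); first exact: schouten0 hP.
  by apply/funext => u; rewrite big_nil.
have := schouten_linearr sn 1 hP (hQ i) (is_multivec_sum s hQ) t.
rewrite smooth_cst1 mul1r IH big_cons => <-; congr (sn P _ t).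
by apply/funext => u; rewrite big_cons mul1r.
Qed.

Lemma schouten_bivector_section P c s : is_multivec 2 P ->
  sn P (mv_section c) s = lie_multivec L c P s.
Proof.
move=> hP; rewrite (schouten_sym sn hP (is_multivec_section c)).
by rewrite -signr_odd expr0 mul1r (schouten_section sn c hP).
Qed.

(** The rule for products reduces [P, a /\ b] to [P, a] and [P, b], which are Lie
derivatives of P. *)
Lemma schouten_bivector_sectionM P a b X Y Z : is_multivec 2 P ->
  sn P (mv_wedge (mv_section a) (mv_section b)) [:: X; Y; Z]
  = cyclic_sum (fun X Y Z : covector A => Z b * lie_multivec L a P [:: X; Y]
      - Z a * lie_multivec L b P [:: X; Y]) X Y Z.
Proof.
move=> hP; have ha := is_multivec_section a; have hb := is_multivec_section b.
rewrite (schouten_wedge sn hP ha hb) mv_wedge21; last first.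
  by have [] := schouten_multivec sn hP ha.
rewrite mv_wedge12; last exact: mv_section_deg.
rewrite !schouten_bivector_section // -signr_odd expr1 /cyclic_sum.
have sk c U V : lie_multivec L c P [:: U; V] = - lie_multivec L c P [:: V; U].
  rewrite !lie_bivectorE (bivector_skew hP U V) (bivector_skew hP (Lie c U)).
  by rewrite (bivector_skew hP U) anchorNr; ring.
by rewrite (sk a Z X) (sk b Z X) /=; ring.
Qed.

(** The bracket with P is a derivation on functions. *)
Lemma schouten_fun_near P (phi : F) (x : M) X : is_multivec 2 P ->
  (\near x, phi x = 1) -> sn P (mv_fun phi) [:: X] x = 0.
Proof.
move=> hP; apply: derivation_local (fun f => sn P (mv_fun f) [:: X]) phi x _.
move=> f g; have hf := is_multivec_fun (A := A) f.
have hg := is_multivec_fun (A := A) g.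
have <- : mv_wedge (mv_fun f) (mv_fun g) = mv_fun (f * g) :> multivec A.
  by apply/funext => s; rewrite mv_wedge_fun; case: s => //= *; rewrite mulr0.
rewrite (schouten_wedge sn hP hf hg) mv_wedge10; last first.
  by have [] := schouten_multivec sn hP hf.
by rewrite mv_wedge_fun muln0 expr0 mul1r addrC [X in _ + X]mulrC.
Qed.

(** In [P, phi Q] = [P, phi] /\ Q + phi [P, Q] the first term vanishes at x. *)
Lemma schouten_near P Q (phi : F) (x : M) X Y Z :
  is_multivec 2 P -> is_multivec 2 Q -> (\near x, phi x = 1) ->
  sn P (fun s => phi * Q s) [:: X; Y; Z] x = sn P Q [:: X; Y; Z] x.
Proof.
move=> hP hQ phi1; have hf := is_multivec_fun (A := A) phi.
have -> : (fun s => phi * Q s) = mv_wedge (mv_fun phi) Q.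
  by apply/funext => s; rewrite mv_wedge_fun.
rewrite (schouten_wedge sn hP hf hQ) mv_wedge12; last first.
  by have [] := schouten_multivec sn hP hf.
rewrite mv_wedge_fun muln0 expr0 mul1r !smooth_funE.
have nf (f : F) : (- f) x = - f x by [].
rewrite nf !smooth_funE !schouten_fun_near // (nbhs_singleton phi1).
ring.
Qed.

Lemma lie_multivecZl f c P X Y : is_multivec 2 P ->
  f * lie_multivec L c P [:: X; Y] = lie_multivec L (f *: c) P [:: X; Y]
    - X c * rho (sharp P Y) f + Y c * rho (sharp P X) f.
Proof.
move=> hP; have [_ lin _] := hP.
rewrite !lie_bivectorE !lieZl (lin [::]) (lin [:: X]) anchorZl.
rewrite /= (bivector_skew hP (_ *: _) Y).
rewrite -(sharpE hP X (_ *: _)) -(sharpE hP Y (_ *: _)).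
rewrite (covectorZE (X c)) (covectorZE (Y c)) !dE; ring.
Qed.

Lemma lie_multivecDl a b P X Y : is_multivec 2 P ->
  lie_multivec L (a + b) P [:: X; Y]
  = lie_multivec L a P [:: X; Y] + lie_multivec L b P [:: X; Y].
Proof.
move=> hP; have [_ lin _] := hP.
rewrite !lie_bivectorE !lieDl anchorDl -[Lie a X]scale1r -[Lie a Y]scale1r.
by rewrite (lin [::]) (lin [:: X]) /= !scale1r; ring.
Qed.

Lemma lie_multivec_sum (I : Type) (s : seq I) (a : I -> section A) P X Y :
  is_multivec 2 P ->
  lie_multivec L (\sum_(i <- s) a i) P [:: X; Y]
  = \sum_(i <- s) lie_multivec L (a i) P [:: X; Y].
Proof.
move=> hP; elim: s => [|i s IH]; last by rewrite !big_cons lie_multivecDl // IH.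
rewrite !big_nil; apply: (@addrI _ (lie_multivec L 0 P [:: X; Y])).
by rewrite -lie_multivecDl // !addr0.
Qed.

Lemma anchor_act_sum (I : Type) (s : seq I) a (f : I -> F) :
  rho a (\sum_(i <- s) f i) = \sum_(i <- s) rho a (f i).
Proof. exact: (big_morph _ (anchor_actD L a) (anchor0r L a)). Qed.

Lemma sum_cyclicD (I : Type) (s : seq I)
    (f g : I -> covector A -> covector A -> covector A -> F) X Y Z :
  \sum_(i <- s) cyclic_sum (fun X Y Z => f i X Y Z + g i X Y Z) X Y Z
  = cyclic_sum (fun X Y Z =>
      \sum_(i <- s) f i X Y Z + \sum_(i <- s) g i X Y Z) X Y Z.
Proof. by rewrite /cyclic_sum !big_split. Qed.

(** The right-hand side depends additively on the bivector a /\ b, through the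
section Z(b) a - Z(a) b and the function X(a) Y(b) - Y(a) X(b), so that it can
be summed over a decomposition of a bivector field. *)
Lemma cyclic_lie_sectionM P a b X Y Z : is_multivec 2 P ->
  cyclic_sum (fun X Y Z : covector A =>
    Z b * lie_multivec L a P [:: X; Y] - Z a * lie_multivec L b P [:: X; Y]) X Y Z
  = cyclic_sum (fun X Y Z : covector A =>
    lie_multivec L (Z b *: a + (- Z a) *: b) P [:: X; Y]
    + rho (sharp P Z) (X a * Y b - Y a * X b)) X Y Z.
Proof.
move=> hP; rewrite /cyclic_sum !lie_multivecDl //.
have e U V W :
    W b * lie_multivec L a P [:: U; V] - W a * lie_multivec L b P [:: U; V]
    = W b * lie_multivec L a P [:: U; V] + - W a * lie_multivec L b P [:: U; V].
  by ring.
by rewrite !e !lie_multivecZl // !anchor_actE; ring.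
Qed.

Context (Pi : multivec A) (hPi : is_multivec 2 Pi).
Local Notation sh := (sharp Pi).

Lemma smooth_cst_half : smooth_cst M 2^-1 * 2 = 1.
Proof. by apply: smooth_fun_eq => x; change (2^-1 * (1 + 1) = 1 :> R); lra. Qed.

(** The frame gives phi Pi(X, Y) = sum_k X(e_k) Pi(ep_k, Y), and antisymmetrising
yields phi Pi = sum_k e_k /\ (1/2 #ep_k). *)
Lemma frame_bivector (phi : F) (e : 'I_r -> section A)
    (ep : 'I_r -> covector A) X Y :
  (forall a, phi *: a = \sum_k ep k a *: e k) ->
  phi * Pi [:: X; Y] = \sum_k (X (e k) * Y (smooth_cst M 2^-1 *: sh (ep k))
    - Y (e k) * X (smooth_cst M 2^-1 *: sh (ep k))).
Proof.
move=> frame.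
have half U V : phi * Pi [:: U; V] = - \sum_k U (sh (ep k)) * V (e k).
  rewrite -(sharpE hPi) -covector_linE frame covector_sum -sumrN.
  by apply: eq_bigr => k _; rewrite covector_linE (sharp_skew hPi); ring.
rewrite -[LHS]mul1r -smooth_cst_half.
rewrite (_ : _ * _ = smooth_cst M 2^-1 * (phi * Pi [:: X; Y])
   - smooth_cst M 2^-1 * (phi * Pi [:: Y; X])); last first.
  by rewrite (bivector_skew hPi Y); ring.
rewrite !half !mulrN opprK addrC !mulr_sumr -sumrN -big_split /=.
by apply: eq_bigr => k _; rewrite !covector_linE; ring.
Qed.

(** By [schouten_near], Pi may be replaced near a point by phi Pi, a finite sum of
products of sections.  The sum of the sections Z(b) a - Z(a) b is then - phi #Z,
and at the point all derivatives of phi vanish.  What remains is the cyclic sum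
of #Z . Pi(X, Y) - (L_#Z Pi)(X, Y), where Leibniz rules give
(L_#Z Pi)(X, Y) = X([#Y, #Z]) + Y([#Z, #X]) - #Z . Pi(X, Y). *)
Lemma schouten_squareE X Y Z :
  sn Pi Pi [:: X; Y; Z] = 2 * poisson_defect L Pi X Y Z.
Proof.
apply: smooth_fun_eq => x.
have [phi [e [ep [phi1 frame]]]] := @local_frame _ _ _ _ A x.
rewrite -(schouten_near X Y Z hPi hPi phi1).
pose b k := smooth_cst M 2^-1 *: sh (ep k).
have frameE U V : phi * Pi [:: U; V]
    = \sum_k (U (e k) * V (b k) - V (e k) * U (b k)) by exact: frame_bivector.
have -> : (fun s => phi * Pi s)
    = fun s => \sum_k mv_wedge (mv_section (e k)) (mv_section (b k)) s.
  apply/funext => s; have [es|ns] := eqVneq (size s) 2.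
    case: s es => [|U [|V []]] // _; rewrite frameE; apply: eq_bigr => k _.
    by rewrite mv_wedge11 //; exact: mv_section_deg.
  have [deg _ _] := hPi; rewrite (deg _ ns) mulr0 big1 // => k _.
  by have [-> //] := is_multivec_sectionM (e k) (b k).
rewrite (schouten_sum _ _ hPi (fun k => is_multivec_sectionM (e k) (b k))).
under eq_bigr => k _ do
  rewrite schouten_bivector_sectionM // cyclic_lie_sectionM //.
have sumE (V : covector A) :
    \sum_k (V (b k) *: e k + (- V (e k)) *: b k) = (- phi) *: sh V.
  apply: section_separated => W; rewrite covector_sum covector_linE.
  rewrite (sharp_skew hPi) sharpE //.
  rewrite mulrNN frameE; apply: eq_bigr => k _; rewrite !covector_linE; ring.
have combE (V W V' : covector A) :
    \sum_k lie_multivec L (V' (b k) *: e k + (- V' (e k)) *: b k) Pi [:: V; W]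
      + \sum_k rho (sh V') (V (e k) * W (b k) - W (e k) * V (b k))
    = - phi * lie_multivec L (sh V') Pi [:: V; W] - V (sh V') * rho (sh W) phi
      + W (sh V') * rho (sh V) phi + rho (sh V') (phi * Pi [:: V; W]).
  rewrite -lie_multivec_sum // -anchor_act_sum sumE -frameE.
  by rewrite lie_multivecZl // !anchorNr; ring.
rewrite sum_cyclicD /cyclic_sum !combE.
have d0 c : rho c phi x = 0.
  apply: (@derivation_local (rho c)) => //; exact: anchor_actM.
have LE V W V' : lie_multivec L (sh V') Pi [:: V; W]
    = V (br (sh W) (sh V')) + W (br (sh V') (sh V)) - rho (sh V') (Pi [:: V; W]).
  rewrite lie_bivectorE (bivector_skew hPi (Lie _ _)) -!(sharpE hPi) !lieE.
  rewrite (bracket_skew L (sh V') (sh W)) !covector_linE !sharpE //.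
  by rewrite (bivector_skew hPi W V) anchorNr; ring.
have one := nbhs_singleton phi1.
have evN (f : F) y : (- f) y = - f y by [].
rewrite !LE /poisson_defect /cyclic_sum !anchor_actM.
rewrite !(evN, smooth_funE) !d0 !one (_ : (1 : F) x = 1) //; ring.
Qed.

End SchoutenSquare.

Theorem theorem3p3 (R : realType) (n r : nat) (M : smooth_manifold R n)
    (A : vector_bundle M r) (L : lie_algebroid A) (sn : schouten_bracket L)
    (Pi : multivec A) (hPi : is_multivec 2 Pi) (xi : section A)
    (lam : covector A) (al be ga : covector A) :
  let T : multivec A := fun s =>
    smooth_cst M (2^-1) * sn Pi Pi s - mv_wedge (mv_section xi) Pi s in
  let S : multivec A := fun s =>
    2 * mv_wedge (mv_section xi) Pi s - sn Pi Pi s in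
  let LPi := lie_multivec L xi Pi in
  jacobiator L Pi xi lam al be ga
  = cyclic_sum (fun a b c => lie_covector L (mv_contract T a b) c) al be ga
    + (S [:: al; be; ga]
       + cyclic_sum (fun a b c : covector A => c xi * LPi [:: a; b]) al be ga)
      *: lam
    + d_fun L (S [:: al; be; ga])
    - cyclic_sum (fun a b c : covector A => c xi *: lie_koszul L xi Pi a b)
        al be ga
    + cyclic_sum (fun a b c => LPi [:: a; b] *: (lie_covector L xi c - c))
        al be ga
    + cyclic_sum (fun a b c =>
          Pi [:: a; b] *: (lie_covector L xi c
                           - twisted_bracket L Pi xi lam lam c)) al be ga.
Proof.
move=> T S LPi.
have wedgeE X Y Z :
    mv_wedge (mv_section xi) Pi [:: X; Y; Z] = wedge_bivector Pi xi X Y Z.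
  rewrite mv_wedge12; last exact: mv_section_deg.
  by rewrite /wedge_bivector /cyclic_sum /= (bivector_skew hPi X Z); ring.
have halfE X Y Z :
    smooth_cst M 2^-1 * sn Pi Pi [:: X; Y; Z] = poisson_defect L Pi X Y Z.
  by rewrite schouten_squareE // mulrA smooth_cst_half mul1r.
have [_ lin3 _] := schouten_multivec sn hPi hPi.
have lin X Y f U V : poisson_defect L Pi X Y (f *: U + V)
    = f * poisson_defect L Pi X Y U + poisson_defect L Pi X Y V.
  by rewrite -!halfE (lin3 [:: X; Y]) /=; ring.
pose C X Y := section_of (poisson_defect L Pi X Y).
have hC (X Y Z : covector A) : Z (C X Y) = poisson_defect L Pi X Y Z.
  exact: section_ofP (lin X Y) Z.
have hT (X Y Z : covector A) :
    Z (mv_contract T X Y)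
    = poisson_defect L Pi X Y Z - wedge_bivector Pi xi X Y Z.
  rewrite -halfE -wedgeE; apply: (section_ofP (t := fun Z => T [:: X; Y; Z])).
  move=> f U V; rewrite /T halfE halfE halfE lin !wedgeE.
  rewrite /wedge_bivector /cyclic_sum !covectorE.
  have [_ linPi _] := hPi.
  by rewrite (linPi [::]) (linPi [:: Y]) /=; ring.
apply: (twisted_jacobiator (xi := xi) (S := S [:: al; be; ga]) hPi lam hC hT).
by rewrite /S wedgeE schouten_squareE.
Qed.
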